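(* Let $\varphi,\psi\in\mathfrak h_{\mathbf R}^*$ be elements belonging to the dominant Weyl chamber $C$. Suppose that both $ih_\varphi, ih_\psi\in\mathfrak g$ have compact isotropy, and that $\varphi'=\lambda\varphi$, $\psi'=\mu\psi$ for some real constants $\lambda,\mu$. Then $\lambda$ and $\mu$ have the same sign (both negative, both zero, or both positive). Moreover, $\varphi$ and $\psi$ are multiples of each other whenever $\lambda,\mu<0$.
   Context: $G$ is a non-compact real semisimple Lie group with Lie algebra $\mathfrak g$ and Killing form $B$; isotropy means stabilizer in $G$ for the adjoint action. $\mathfrak g=\mathfrak k\oplus\mathfrak p$ is a Cartan decomposition with $\mathfrak k$ a maximal compact subalgebra, and $\mathfrak h_0\subset\mathfrak k$ is a maximal abelian subalgebra whose complexification is a Cartan subalgebra of $\mathfrak g_c=\mathfrak g\otimes\mathbf C$. $\Delta$ is the set of roots, which are real on $\mathfrak h_{\mathbf R}=i\mathfrak h_0$, where $B$ is positive definite. For $\psi\in\mathfrak h_{\mathbf R}^*$, $h_\psi\in\mathfrak h_{\mathbf R}$ is defined by $\psi(h)=B(h_\psi,h)$, and $(\psi,\psi')=B(h_\psi,h_{\psi'})$ is the induced scalar product on $\mathfrak h_{\mathbf R}^*$. A root $\alpha$ is compact ($\varepsilon_\alpha=-1$) if its root space lies in $\mathfrak k_c$, and non-compact ($\varepsilon_\alpha=1$) if it lies in $\mathfrak p_c$. A positive root system $\Delta^+\subset\Delta$ is fixed, and $C=\{\psi\in\mathfrak h_{\mathbf R}^*:(\psi,\alpha)\ge0\text{ for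 all }\alpha\in\Delta^+\}$ is its dominant Weyl chamber. For $\varphi\in C$, let $\varphi^\perp$ be the set of elements orthogonal to $\varphi$ and $$\varphi'=-2\sum_{\alpha\in\Delta^+\setminus\varphi^\perp}\varepsilon_\alpha\,\alpha\in\mathfrak h_{\mathbf R}^*;$$ $\psi'$ is defined likewise from $\psi$. *)

(* Defs.v *)
From HB Require Import structures.
From mathcomp Require Import all_boot all_order all_algebra.
From mathcomp Require Import all_classical all_reals all_analysis.
From mathcomp Require Import complex.

Set Implicit Arguments.
Unset Strict Implicit.
Unset Printing Implicit Defensive.

Import Order.TTheory GRing.Theory Num.Theory numFieldNormedType.Exports.

Local Open Scope classical_set_scope.
Local Open Scope ring_scope.
Local Open Scope complex_scope.

(* [k] times continuously differentiable on [U], for [U] open. *)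
Fixpoint Ck {R : realType} {V W : normedModType R} (k : nat)
    (U : set V) (f : V -> W) : Prop :=
  match k with
  | 0 => {in U, continuous f}
  | k'.+1 => {in U, forall x, differentiable f x} /\
             forall v : V, Ck k' U (fun x => 'D_v f x)
  end.

Definition smooth_on {R : realType} {V W : normedModType R}
    (U : set V) (f : V -> W) : Prop :=
  open U /\ forall k, Ck k U f.

(* [cmap] is only meaningful on [cdom], and [cinv] only on the image of [cdom]
   under [cmap]. *)
Record chart (R : realType) (n : nat) (T : topologicalType) := Chart {
  cdom : set T;
  cmap : T -> 'rV[R]_n;
  cinv : 'rV[R]_n -> T;
  cdom_open : open cdom;
  cim_open : open (cmap @` cdom);
  cmapK : {in cdom, cancel cmap cinv};
  cmap_continuous : {in cdom, continuous cmap};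
  cinv_continuous : {in cmap @` cdom, continuous cinv}
}.

Definition cim {R : realType} {n : nat} {T : topologicalType}
  (c : chart R n T) : set 'rV[R]_n := cmap c @` cdom c.

HB.mixin Record isLieGroup (R : realType) (n : nat) (G : Type)
    of Group G & Topological G := {
  atlas : set (chart R n G);
  atlas_cover : \bigcup_(c in atlas) cdom c = [set: G];
  atlas_compatible : forall c d, atlas c -> atlas d ->
    smooth_on [set x | cim c x /\ cdom d (cinv c x)]
              (fun x => cmap d (cinv c x));
  lie_hausdorff : hausdorff_space G;
  lie_second_countable : @second_countable G;
  mulg_continuous : continuous (fun z : G * G => (z.1 * z.2)%g);
  invg_continuous : continuous (fun g : G => (g^-1)%g);
  mulg_smooth : forall a b c, atlas a -> atlas b -> atlas c ->
    smooth_on [set z | [/\ cim a z.1, cim b z.2 &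
                         cdom c (cinv a z.1 * cinv b z.2)%g]]
              (fun z => cmap c (cinv a z.1 * cinv b z.2)%g);
  invg_smooth : forall a c, atlas a -> atlas c ->
    smooth_on [set x | cim a x /\ cdom c (cinv a x)^-1%g]
              (fun x => cmap c (cinv a x)^-1%g)
}.

#[short(type="lieGroupType")]
HB.structure Definition LieGroup (R : realType) (n : nat) :=
  { G of isLieGroup R n G & Group G & Topological G }.

Section LieAlgebraOf.
Variables (R : realType) (n : nat) (G : lieGroupType R n) (c : chart R n G).

(* A chart [c] around the unit identifies the tangent space of [G] at the unit
   with ['rV[R]_n].  In these coordinates, [Ad g] is the differential at the
   unit of conjugation by [g], and the Lie bracket is the differential of [Ad]
   at the unit. *)
Definition Ad (g : G) (v : 'rV[R]_n) : 'rV[R]_n :=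
  'D_v (fun x => cmap c (g * cinv c x * g^-1)%g) (cmap c 1%g).

Definition lie_bracket (u v : 'rV[R]_n) : 'rV[R]_n :=
  'D_u (fun x => Ad (cinv c x) v) (cmap c 1%g).

Definition isotropy (v : 'rV[R]_n) : set G := [set g | Ad g v = v].

End LieAlgebraOf.

Section LieAlgebra.
Variables (F : fieldType) (n : nat) (br : 'rV[F]_n -> 'rV[F]_n -> 'rV[F]_n).

Definition ad_mx (x : 'rV[F]_n) : 'M[F]_n := lin1_mx (br x).

Definition killing (x y : 'rV[F]_n) : F := \tr (ad_mx x *m ad_mx y).

(* Semisimplicity is taken to mean non-degeneracy of the Killing form. *)
Definition semisimple : Prop :=
  forall x, (forall y, killing x y = 0) -> x = 0.

Definition lie_subalgebra (H : set 'rV[F]_n) : Prop :=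
  [/\ H 0,
      forall a x y, H x -> H y -> H (a *: x + y) &
      forall x y, H x -> H y -> H (br x y)].

(* All iterated brackets [x_1, [x_2, ... [x_m, y] ... ]] vanish, that is, the
   [m]-th term of the lower central series is zero. *)
Definition nilpotent_subalgebra (H : set 'rV[F]_n) : Prop :=
  exists m : nat, forall (s : m.-tuple 'rV[F]_n) (y : 'rV[F]_n),
    (forall x, x \in s -> H x) -> H y -> foldr br y s = 0.

Definition cartan_subalgebra (H : set 'rV[F]_n) : Prop :=
  [/\ lie_subalgebra H, nilpotent_subalgebra H &
      forall x, (forall y, H y -> H (br x y)) -> H x].

Definition abelian_subspace (a : {vspace 'rV[F]_n}) : Prop :=
  forall x y, x \in a -> y \in a -> br x y = 0.

Definition maximal_abelian_in (k a : {vspace 'rV[F]_n}) : Prop :=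
  [/\ (a <= k)%VS, abelian_subspace a &
      forall b, (a <= b <= k)%VS -> abelian_subspace b -> b = a].

End LieAlgebra.

Section CartanDecomposition.
Variables (R : realType) (n : nat) (br : 'rV[R]_n -> 'rV[R]_n -> 'rV[R]_n).
Implicit Types k p : {vspace 'rV[R]_n}.

Definition cartan_involution (theta : 'End('rV[R]_n)) : Prop :=
  [/\ forall x, theta (theta x) = x,
      forall x y, theta (br x y) = br (theta x) (theta y) &
      forall x, x != 0 -> 0 < - killing br x (theta x)].

Definition cartan_decomposition k p : Prop :=
  exists theta, [/\ cartan_involution theta,
    forall x, (x \in k) = (theta x == x) &
    forall x, (x \in p) = (theta x == - x)].

End CartanDecomposition.

Section Complexification.
Variables (R : realType) (n : nat) (br : 'rV[R]_n -> 'rV[R]_n -> 'rV[R]_n).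

Definition cplx (x : 'rV[R]_n) : 'rV[R[i]]_n := map_mx (fun t : R => t%:C) x.
Definition re_part (z : 'rV[R[i]]_n) : 'rV[R]_n := map_mx (@complex.Re R) z.
Definition im_part (z : 'rV[R[i]]_n) : 'rV[R]_n := map_mx (@complex.Im R) z.

Definition cbr (z w : 'rV[R[i]]_n) : 'rV[R[i]]_n :=
  cplx (br (re_part z) (re_part w) - br (im_part z) (im_part w)) +
  'i *: cplx (br (re_part z) (im_part w) + br (im_part z) (re_part w)).

Definition csubspace (U : {vspace 'rV[R]_n}) : set 'rV[R[i]]_n :=
  [set z | re_part z \in U /\ im_part z \in U].

End Complexification.

Section Roots.
Variables (R : realType) (n : nat) (br : 'rV[R]_n -> 'rV[R]_n -> 'rV[R]_n).
Variables (k p h0 : {vspace 'rV[R]_n}).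

(* The real space [h_R = i h0] is represented by the vector space underlying
   [h0], a vector [x] of which stands for the element [toC x = i x] of the
   complexified Lie algebra. *)
Definition hR := subvs_of h0.
Definition toC (x : hR) : 'rV[R[i]]_n := 'i *: cplx (vsval x).

Definition hRdual := 'Hom(hR, R^o).

Implicit Types phi psi alpha : hRdual.

(* Since [h_R] spans the complexification of [h0] over the complex numbers, a
   root is determined by its (real) restriction to [h_R]. *)
Definition root_space alpha : set 'rV[R[i]]_n :=
  [set z | forall h : hR, cbr br (toC h) z = (alpha h : R)%:C *: z].

Definition roots : set hRdual :=
  [set alpha | alpha != 0 /\ exists2 z, root_space alpha z & z != 0].

(* The vector h_phi of h_R such that phi h = B(h_phi, h) for all h in h_R; it
   exists and is unique when B is positive definite on h_R. *)
Definition hvec phi : hR :=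
  xget 0 [set x | forall h : hR,
            (phi h : R)%:C = killing (cbr br) (toC x) (toC h)].

Definition ip phi psi : R :=
  complex.Re (killing (cbr br) (toC (hvec phi)) (toC (hvec psi))).

(* The element i h_phi of the real Lie algebra; see [cplx_ihvec]. *)
Definition ihvec phi : 'rV[R]_n := - vsval (hvec phi).

Lemma cplx_ihvec phi : cplx (ihvec phi) = 'i *: toC (hvec phi).
Proof.
rewrite /toC scalerA; apply/rowP => j; rewrite !mxE.
by simpc.
Qed.

Definition compact_root alpha : Prop := root_space alpha `<=` csubspace k.
Definition noncompact_root alpha : Prop := root_space alpha `<=` csubspace p.

(* The value 0 is never taken on roots: the root spaces are one-dimensional and
   stable under the Cartan involution. *)
Definition epsilon alpha : R :=
  if `[< compact_root alpha >] then -1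
  else if `[< noncompact_root alpha >] then 1 else 0.

Definition positive_system (D : set hRdual) : Prop :=
  [/\ D `<=` roots,
      forall alpha, roots alpha -> D alpha \/ D (- alpha),
      forall alpha, D alpha -> ~ D (- alpha) &
      forall alpha beta, D alpha -> D beta -> roots (alpha + beta) ->
        D (alpha + beta)].

Variable Dpos : set hRdual.

Definition dominant_chamber : set hRdual :=
  [set phi | forall alpha, Dpos alpha -> 0 <= ip phi alpha].

Definition orth phi : set hRdual := [set psi | ip phi psi = 0].

(* The functional usually written phi'. *)
Definition prime_dual phi : hRdual :=
  - 2 *: \sum_(alpha \in Dpos `\` orth phi) (epsilon alpha *: alpha).

End Roots.

(* Main.v *)
Require Import Defs.
From HB Require Import structures.
From mathcomp Require Import all_boot all_order all_algebra.
From mathcomp Require Import all_classical all_reals all_analysis.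
From mathcomp Require Import complex ring lra.

Set Implicit Arguments.
Unset Strict Implicit.
Unset Printing Implicit Defensive.

Import Order.TTheory GRing.Theory Num.Theory numFieldNormedType.Exports.

Local Open Scope classical_set_scope.
Local Open Scope ring_scope.

(** The Killing form is a trace form, so the scalar product of two functionals
    is a sum over weights,
      (phi, psi) = sum_d (phi, d) (psi, d),
    where d runs over the simultaneous eigenvalues of ad(i h0), that is over
    the roots and 0 ([weights]).  For dominant phi and psi all these terms are
    nonnegative, and (phi, psi) > 0 as soon as one root is orthogonal to
    neither.

    Compactness of the isotropy of i h_phi forces every root orthogonal to phi
    to be compact.  Otherwise a root vector can be projected to p and yields a
    nonzero x in p with [x, i h_phi] = 0 ([noncompact_vector]).  As ad x is symmetric and nonzero, it has a nonzero
    real eigenvalue, so the one-parameter group of x would be a subset of the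
    isotropy on which Ad is unbounded ([isotropy_noncompact]).

    Hence in the sum over all positive roots -2 sum eps_alpha alpha, the terms
    left out of phi' pair nonnegatively with psi, whereas the terms left out of
    psi' are orthogonal to psi: (phi', psi) <= (psi', psi)
    ([pd_comparison]).  If phi' = lambda phi and psi' = mu psi this reads
      lambda (phi, psi) <= mu (psi, psi)  and  mu (phi, psi) <= lambda (phi, phi).
    If some positive root is not compact then (phi, psi) > 0, since that root is
    orthogonal neither to phi nor to psi, and the two inequalities give equal
    signs.  If all positive roots are compact then (phi', phi) > 0 and
    (psi', psi) > 0, so both constants are positive.  When lambda and mu are
    negative, multiplying the inequalities gives
    (phi, phi) (psi, psi) <= (phi, psi)^2, the equality case of Cauchy-Schwarz.
    Both functionals are nonzero because the isotropy of 0 is the whole group.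

    The group is only known through smooth charts.  Everything about Ad is
    deduced from differentiability at the unit of conjugation and of
    x |-> Ad x v ([differentiable_chart_conj], [differentiable_Ad]): bilinearity
    of the bracket, invariance under Ad, and, by differentiating the invariance,
    the Jacobi identity.  One-parameter groups are replaced by limit points of
    powers of elements close to the unit ([exists_exp_like]). *)

(** * Linear algebra *)

Lemma mul_rV_linear (S : comNzRingType) m p (f : 'rV[S]_m -> 'rV[S]_p) :
  linear f -> forall u, u *m lin1_mx f = f u.
Proof.
move=> flin u; pose F : {linear _ -> _} := HB.pack f (GRing.isLinear.Build _ _ _ _ f flin).
exact: (mul_rV_lin1 F).
Qed.

Lemma row_eq_mx (S : comNzRingType) m p (M N : 'M[S]_(m, p)) :
  (forall u : 'rV_m, u *m M = u *m N) -> M = N.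
Proof. by move=> MN; apply/row_matrixP => i; rewrite !rowE. Qed.

Lemma linear_row_sum (R : comNzRingType) n (W : lmodType R) (f : 'rV[R]_n -> W) u :
  linear f -> f u = \sum_i u 0 i *: f (delta_mx 0 i).
Proof.
move=> flin.
pose F : {linear 'rV[R]_n -> W} := HB.pack f (GRing.isLinear.Build _ _ _ _ f flin).
rewrite -[f]/(F : _ -> _) {1}(row_sum_delta u) linear_sum.
by apply: eq_bigr => i _; rewrite linearZ.
Qed.

Lemma linear_sub (R : comNzRingType) (V W : lmodType R) (f g : V -> W) :
  linear f -> linear g -> linear (fun w => f w - g w).
Proof.
by move=> fl gl r u v; rewrite fl gl scalerBr opprD addrACA.
Qed.

(** The map x |-> f x is injective, hence onto, by equality of dimensions. *)
Lemma riesz_representation (F : fieldType) (V : vectType F) (f : V -> V -> F) :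
  (forall y, scalar (f^~ y)) -> (forall x, scalar (f x)) ->
  (forall x, (forall y, f x y = 0) -> x = 0) ->
  forall phi : 'Hom(V, F^o), exists x, forall y, phi y = f x y.
Proof.
move=> linl linr nondeg.
pose fr x : {linear V -> F^o} :=
  HB.pack (f x : V -> F^o) (GRing.isLinear.Build _ _ _ _ (f x : V -> F^o) (linr x)).
pose g x : 'Hom(V, F^o) := linfun (fr x).
have gE x y : g x y = f x y by rewrite lfunE.
have glin : linear g.
  by move=> a x x'; apply/lfunP => y; rewrite add_lfunE scale_lfunE !gE linl.
pose gL : {linear V -> 'Hom(V, F^o)} := HB.pack g (GRing.isLinear.Build _ _ _ _ g glin).
pose G := linfun gL.
have GE x : G x = g x by rewrite lfunE.
have ker0 : (lker G = 0)%VS.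
  apply/eqP; rewrite -subv0; apply/subvP => x; rewrite memv_ker memv0 => /eqP Gx.
  by apply/eqP/nondeg => y; rewrite -gE -GE Gx zero_lfunE.
have full : (limg G = fullv)%VS.
  apply/eqP; rewrite eqEdim subvf limg_dim_eq ?ker0 ?capv0 //.
  by rewrite !dimvf /dim /= muln1.
move=> phi; have : phi \in limg G by rewrite full memvf.
by move=> /memv_imgP[x _ ->]; exists x => y; rewrite GE gE.
Qed.

Section SelfAdjoint.
Local Open Scope sesquilinear_scope.

(** After passing to an orthonormal basis of the form M the matrices become
    hermitian; they have a common unitary triangularization, and a triangular
    hermitian matrix is diagonal and real. *)
Lemma selfadjoint_codiagonalizable (C : numClosedFieldType) n (M : 'M[C]_n)
    (As : seq 'M[C]_n) :
  M ^t* = M -> (forall u : 'rV_n, u != 0 -> 0 < (u *m M *m u ^t*) 0 0) ->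
  {in As, forall A, A *m M = M *m A ^t*} ->
  {in As &, forall A B, comm_mx A B} ->
  exists2 P : 'M[C]_n, P \in unitmx &
    {in As, forall A, exists2 d : 'rV[C]_n,
       (forall j, d 0 j \is Num.real) & P *m A = diag_mx d *m P}.
Proof.
move=> Mherm Mpos Asadj Acomm.
have Mn : M \is normalmx by apply/normalmxP; rewrite Mherm.
move: (orthomx_spectralP Mn).
set U := spectralmx M; set D := spectral_diag M => ME.
have Uu : U \is unitarymx := spectral_unitarymx M.
have Uunit := unitarymx_unit Uu.
have UMU : U *m M *m U ^t* = diag_mx D.
  by rewrite -invmx_unitary // {1}ME !mulmxA mulmxV // mul1mx mulmxK.
have Dpos j : 0 < D 0 j.
  have : 0 < (row j U *m M *m (row j U) ^t*) 0 0.
    apply: Mpos; apply/eqP => r0.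
    have : row j (U *m invmx U) = 0 by rewrite row_mul r0 mul0mx.
    by rewrite mulmxV // => /rowP/(_ j)/eqP; rewrite !mxE eqxx oner_eq0.
  suff -> : (row j U *m M *m (row j U) ^t*) 0 0 = (U *m M *m U ^t*) j j.
    by rewrite UMU !mxE eqxx.
  by rewrite -row_mul !mxE; apply: eq_bigr => i _; rewrite !mxE.
(* the rows of Q form an orthonormal basis for M *)
pose s : 'rV[C]_n := \row_j (sqrtC (D 0 j))^-1.
pose Q := diag_mx s *m U.
have QM : Q *m M *m Q ^t* = 1%:M.
  rewrite /Q trmx_mul map_mxM !mulmxA.
  rewrite -(mulmxA _ M) -(mulmxA _ U) (mulmxA U) UMU tr_diag_mx map_diag_mx.
  rewrite !mulmx_diag; apply/matrixP => i j; rewrite !mxE.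
  case: eqP => [->|//]; rewrite !mulr1n.
  have sp : 0 < sqrtC (D 0 j) by rewrite sqrtC_gt0.
  rewrite fmorphV /= (CrealP (ger0_real (ltW sp))) -{2}(sqrtCK (D 0 j)).
  by rewrite expr2 mulKf ?gt_eqF // mulfV ?gt_eqF.
have Qunit : Q \in unitmx by move: QM; rewrite -mulmxA => /mulmx1_unit[].
have QV : invmx Q = M *m Q ^t*.
  by apply: (can_inj (mulKmx Qunit)); rewrite mulmxV // mulmxA QM.
clearbody Q.
pose f A := Q *m A *m invmx Q.
have fherm A : A \in As -> (f A) ^t* = f A.
  move=> AAs; rewrite /f QV mulmxA -(mulmxA Q) (Asadj _ AAs).
  by rewrite !trmx_mul !map_mxM !trmxCK Mherm -Asadj // !mulmxA.
have [|P0 P0u /allP P0trig] := @cotrigonalization _ _ (map f As).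
  move=> _ _ /mapP[A AAs ->] /mapP[B BAs ->].
  by rewrite /f /comm_mx !mulmxA !mulmxKV // -!(mulmxA Q) (Acomm A B).
have P0unit := unitarymx_unit P0u.
exists (P0 *m Q); first by rewrite unitmx_mul P0unit.
move=> A AAs.
have : is_trig_mx (conjmx P0 (f A)) := P0trig _ (map_f f AAs).
rewrite conjumx // invmx_unitary //.
set T := P0 *m f A *m P0 ^t* => Ttrig.
have Therm i j : T i j = (T j i)^*.
  have TH : T ^t* = T.
    rewrite /T; move: (f A) (fherm A AAs) => F FE.
    by rewrite !trmx_mul !map_mxM !trmxCK FE mulmxA.
  by rewrite -[in LHS]TH mxE [in LHS]mxE.
pose d : 'rV[C]_n := \row_j T j j.
have Td : T = diag_mx d.
  apply/matrixP => i j; rewrite [RHS]mxE [d _ _]mxE; case: (ltngtP i j) => [ij|ji|/val_inj ->].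
  - by move/is_trig_mxP: Ttrig => ->; rewrite // (_ : i == j = false) // -val_eqE ltn_eqF.
  - rewrite Therm; move/is_trig_mxP: Ttrig => ->; rewrite // conjC0.
    by rewrite (_ : i == j = false) // -val_eqE gtn_eqF.
  - by rewrite eqxx.
exists d; first by move=> j; rewrite [d _ _]mxE; apply/CrealP; rewrite -Therm.
rewrite -Td /T /f -invmx_unitary // !mulmxA.
by rewrite -(mulmxA _ (invmx P0)) mulVmx // mulmx1 mulmxKV.
Qed.

End SelfAdjoint.

(** * The Killing form and Cartan involutions *)

Section LieAlgebra.
Variables (R : realType) (n : nat) (br : 'rV[R]_n -> 'rV[R]_n -> 'rV[R]_n).
Hypothesis br_linl : forall y, linear (br^~ y).
Hypothesis br_linr : forall x, linear (br x).
Hypothesis br_leibniz : forall u x y,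
  br u (br x y) = br (br u x) y + br x (br u y).
Hypothesis br_semisimple : semisimple br.

Local Notation ad := (ad_mx br).
Local Notation B := (killing br).

Lemma brDl x y z : br (x + y) z = br x z + br y z.
Proof. by have := br_linl z 1 x y; rewrite !scale1r. Qed.

Lemma brDr x y z : br x (y + z) = br x y + br x z.
Proof. by have := br_linr x 1 y z; rewrite !scale1r. Qed.

Lemma br0l z : br 0 z = 0.
Proof. by apply: (addrI (br 0 z)); rewrite -brDl !addr0. Qed.

Lemma br0r z : br z 0 = 0.
Proof. by apply: (addrI (br z 0)); rewrite -brDr !addr0. Qed.

Lemma brZl a x z : br (a *: x) z = a *: br x z.
Proof. by have := br_linl z a x 0; rewrite br0l !addr0. Qed.

Lemma brZr a x z : br z (a *: x) = a *: br z x.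
Proof. by have := br_linr z a x 0; rewrite br0r !addr0. Qed.

Lemma brNl x z : br (- x) z = - br x z.
Proof. by rewrite -scaleN1r brZl scaleN1r. Qed.

Lemma mul_ad x y : y *m ad x = br x y.
Proof. exact/mul_rV_linear. Qed.

Lemma ad_linear : linear ad.
Proof.
move=> a x y; apply: row_eq_mx => u.
by rewrite mulmxDr -scalemxAr !mul_ad br_linl.
Qed.

(** Matrices act on row vectors from the right, hence the order of the
    factors. *)
Lemma ad_br x y : ad (br x y) = ad y *m ad x - ad x *m ad y.
Proof.
apply: row_eq_mx => u; rewrite mulmxBr !mulmxA !mul_ad.
by rewrite (br_leibniz x y u) addrK.
Qed.

Lemma killingC x y : B x y = B y x.
Proof. exact: mxtrace_mulC. Qed.

Lemma killing_linl y : scalar (B^~ y).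
Proof.
by move=> a x x'; rewrite /killing ad_linear mulmxDl -scalemxAl mxtraceD mxtraceZ.
Qed.

Lemma killing_linr x : scalar (B x).
Proof. by move=> a y y'; rewrite killingC killing_linl !(killingC x). Qed.

Lemma killing0r x : B x 0 = 0.
Proof.
rewrite /killing (_ : ad 0 = 0) ?mulmx0 ?mxtrace0 //.
by apply: row_eq_mx => u; rewrite mul_ad br0l mulmx0.
Qed.

Lemma killingNr x y : B x (- y) = - B x y.
Proof. by have := killing_linr x (-1) y 0; rewrite addr0 scaleN1r mulN1r killing0r addr0. Qed.

Lemma killing_invariant h x y : B (br h x) y = - B x (br h y).
Proof.
rewrite /killing !ad_br mulmxBl mulmxBr !raddfB /= opprK addrC !mulmxA.
by rewrite -(mulmxA (ad h)) mxtrace_mulC.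
Qed.

(** The square [x, x] acts trivially since ad is a morphism for commutators, so
    it lies in the radical of the Killing form. *)
Lemma br_alt x : br x x = 0.
Proof.
apply: br_semisimple => y.
by rewrite /killing ad_br subrr mul0mx mxtrace0.
Qed.

Lemma br_anti x y : br x y = - br y x.
Proof.
apply/eqP; rewrite -addr_eq0; have := br_alt (x + y).
by rewrite brDl !brDr !br_alt addr0 add0r => ->.
Qed.

Section Cartan.
Variable theta : 'End('rV[R]_n).
Hypothesis theta_cartan : cartan_involution br theta.

Let thetaK x : theta (theta x) = x.
Proof. by case: theta_cartan. Qed.

Let theta_br x y : theta (br x y) = br (theta x) (theta y).
Proof. by case: theta_cartan. Qed.

(** An automorphism conjugates ad x into ad (theta x), which leaves traces
    unchanged. *)
Lemma killing_theta x y : B (theta x) (theta y) = B x y.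
Proof.
pose T := lin1_mx theta.
have TE u : u *m T = theta u by apply: mul_rV_linear => a v w; rewrite linearP.
have TT : T *m T = 1%:M by apply: row_eq_mx => u; rewrite mulmxA !TE thetaK mulmx1.
have adT z : ad (theta z) = T *m ad z *m T.
  by apply: row_eq_mx => u; rewrite !mulmxA !TE !mul_ad theta_br thetaK.
rewrite /killing !adT !mulmxA -(mulmxA _ T T) TT mulmx1.
by rewrite mxtrace_mulC !mulmxA TT mul1mx.
Qed.

(** The positive definite form attached to a Cartan involution: ad h is skew for
    it when h is fixed by theta, and symmetric when theta h = - h. *)
Definition form_theta x y : R := - B x (theta y).
Local Notation Bt := form_theta.

Lemma form_thetaC x y : Bt x y = Bt y x.
Proof. by rewrite /Bt -killing_theta thetaK killingC. Qed.

Lemma form_theta_gt0 x : x != 0 -> 0 < Bt x x.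
Proof. by case: theta_cartan => _ _; apply. Qed.

Lemma form_theta_linl y : scalar (Bt^~ y).
Proof. by move=> a x x'; rewrite /Bt killing_linl opprD mulrN. Qed.

Lemma form_theta_linr x : scalar (Bt x).
Proof. by move=> a y y'; rewrite form_thetaC form_theta_linl !(form_thetaC x). Qed.

Lemma form_theta_skew h x y : theta h = h -> Bt (br h x) y = - Bt x (br h y).
Proof. by move=> hE; rewrite /Bt killing_invariant theta_br hE opprK. Qed.

Lemma form_theta_sym p x y : theta p = - p -> Bt (br p x) y = Bt x (br p y).
Proof.
move=> pE; rewrite /Bt killing_invariant theta_br pE opprK.
by rewrite brNl killingNr opprK.
Qed.

End Cartan.
End LieAlgebra.

(** * Complexification and Gram matrices *)

Section Complexify.
Variables (R : realType).
Local Open Scope complex_scope.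
Local Open Scope sesquilinear_scope.

Local Notation cmx := (map_mx (real_complex R)).

Lemma cplx_re_im n (z : 'rV[R[i]]_n) : z = cplx (re_part z) + 'i *: cplx (im_part z).
Proof. by apply/rowP => j; rewrite !mxE; exact: complexE. Qed.

Lemma re_part_cplx n (x y : 'rV[R]_n) : re_part (cplx x + 'i *: cplx y) = x.
Proof. by apply/rowP => j; rewrite !mxE; simpc. Qed.

Lemma im_part_cplx n (x y : 'rV[R]_n) : im_part (cplx x + 'i *: cplx y) = y.
Proof. by apply/rowP => j; rewrite !mxE; simpc. Qed.

Lemma cplx_inj n (x y x' y' : 'rV[R]_n) :
  cplx x + 'i *: cplx y = cplx x' + 'i *: cplx y' -> x = x' /\ y = y'.
Proof.
move=> e; split.
  by rewrite -(re_part_cplx x y) e re_part_cplx.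
by rewrite -(im_part_cplx x y) e im_part_cplx.
Qed.

Lemma conj_realc (x : R) : (x%:C)^*%R = x%:C.
Proof. by apply/CrealP/complex_realP; exists x. Qed.

Lemma conj_ic : ('i%C : R[i])^*%R = - 'i%C.
Proof. by rewrite complexiE conjCi. Qed.

Lemma trC_cmx m n (A : 'M[R]_(m, n)) : (cmx A) ^t* = cmx A^T.
Proof. by apply/matrixP => i j; rewrite !mxE; exact: conj_realc. Qed.

Lemma trC_icmx m n (A : 'M[R]_(m, n)) : ('i *: cmx A) ^t* = - ('i *: cmx A^T).
Proof.
by apply/matrixP => i j; rewrite !mxE rmorphM /= conj_realc conj_ic mulNr.
Qed.

Lemma scalar_sum n (f : 'rV[R]_n -> R) u :
  scalar f -> f u = \sum_i u 0 i * f (delta_mx 0 i).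
Proof. exact: (linear_row_sum (W := R^o)). Qed.

Section Gram.
Variables (n : nat) (b : 'rV[R]_n -> 'rV[R]_n -> R).
Hypothesis b_linl : forall y, scalar (b^~ y).
Hypothesis b_linr : forall x, scalar (b x).
Hypothesis bC : forall x y, b x y = b y x.
Hypothesis b_gt0 : forall x, x != 0 -> 0 < b x x.

Definition gram := \matrix_(i, j) b (delta_mx 0 i) (delta_mx 0 j).

Lemma gramE u w : (u *m gram *m w^T) 0 0 = b u w.
Proof.
rewrite (scalar_sum w (b_linr u)) mxE; apply: eq_bigr => j _.
rewrite mulrC !mxE (scalar_sum u (b_linl _)); congr (_ * _).
by apply: eq_bigr => i _; rewrite mxE.
Qed.

Lemma gram_sym : gram^T = gram.
Proof. by apply/matrixP => i j; rewrite !mxE bC. Qed.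

Lemma gram_gt0 (u : 'rV[R[i]]_n) : u != 0 -> 0 < (u *m cmx gram *m u ^t*) 0 0.
Proof.
move=> u0; set X := re_part u; set Y := im_part u.
suff -> : (u *m cmx gram *m u ^t*) 0 0 = (b X X + b Y Y)%:C.
  have b0 x : 0 <= b x x.
    have [->|/b_gt0/ltW//] := eqVneq x 0.
    by have := b_linl 0 (-1) 0 0; rewrite scaler0 addr0 mulN1r addNr => ->.
  (* for u = X + i Y the hermitian form takes the value b X X + b Y Y *)
  rewrite ltcR; have [X0|X0] := eqVneq X 0; last by rewrite ltr_pwDl // b_gt0.
  rewrite ltr_wpDl // b_gt0 //; apply: contra_neq u0 => Y0.
  by rewrite (cplx_re_im u) -/X -/Y X0 Y0 /cplx map_mx0 scaler0 addr0.
have -> : u ^t* = cmx X^T - 'i *: cmx Y^T.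
  rewrite {1}(cplx_re_im u) linearD /= map_mxD.
  by congr (_ + _); [exact: trC_cmx | exact: trC_icmx].
rewrite {1}(cplx_re_im u) -/X -/Y /cplx mulmxDl mulmxBr !mulmxDl.
rewrite -!scalemxAl -!scalemxAr -!map_mxM.
have DE (A A' : 'M[R[i]]_1) : (A + A') 0 0 = A 0 0 + A' 0 0 by rewrite mxE.
have NE (A : 'M[R[i]]_1) : (- A) 0 0 = - A 0 0 by rewrite mxE.
have ZE a (A : 'M[R[i]]_1) : (a *: A) 0 0 = a * A 0 0 by rewrite mxE.
have CE (A : 'M[R]_1) : (cmx A) 0 0 = (A 0 0)%:C by rewrite mxE.
rewrite !(DE, NE, ZE, CE) !gramE.
rewrite (bC Y X) [in X in _ - X]mulrA -expr2 sqr_i mulN1r rmorphD /=.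
by rewrite opprD opprK addrA addrK.
Qed.

(** A symmetric real matrix A stays self-adjoint over the complex numbers; for a
    skew A it is i A that is self-adjoint. *)
Lemma gram_sym_adj (A : 'M[R]_n) :
  (forall x y, b (x *m A) y = b x (y *m A)) ->
  cmx A *m cmx gram = cmx gram *m (cmx A) ^t*.
Proof.
move=> AB; rewrite trC_cmx -!map_mxM; congr (cmx _).
apply/matrixP => i j.
have E (N : 'M[R]_n) :
    N i j = ((delta_mx 0 i : 'rV_n) *m N *m (delta_mx 0 j : 'rV_n)^T) 0 0.
  by rewrite -rowE trmx_delta -colE !mxE.
rewrite E [RHS]E !mulmxA gramE -(mulmxA (_ *m gram)) -trmx_mul gramE.
exact: AB.
Qed.

Lemma gram_skew_adj (A : 'M[R]_n) :
  (forall x y, b (x *m A) y = - b x (y *m A)) ->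
  ('i *: cmx A) *m cmx gram = cmx gram *m ('i *: cmx A) ^t*.
Proof.
move=> AB; rewrite trC_icmx mulmxN -scalemxAl -scalemxAr -!map_mxM -scalerN -map_mxN.
congr (_ *: cmx _); apply/matrixP => i j.
have E (N : 'M[R]_n) :
    N i j = ((delta_mx 0 i : 'rV_n) *m N *m (delta_mx 0 j : 'rV_n)^T) 0 0.
  by rewrite -rowE trmx_delta -colE !mxE.
rewrite E [RHS]E !mulmxA gramE mulmxN mulNmx mxE !mulmxA.
by rewrite -(mulmxA (_ *m gram)) -trmx_mul gramE.
Qed.

End Gram.
End Complexify.

(** * Weights of the compact Cartan subalgebra *)

Section Weights.
Variables (R : realType) (n : nat) (br : 'rV[R]_n -> 'rV[R]_n -> 'rV[R]_n).
Hypothesis br_linl : forall y, linear (br^~ y).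
Hypothesis br_linr : forall x, linear (br x).
Hypothesis br_leibniz : forall u x y,
  br u (br x y) = br (br u x) y + br x (br u y).
Variable theta : 'End('rV[R]_n).
Hypothesis theta_cartan : cartan_involution br theta.
Variable h0 : {vspace 'rV[R]_n}.
Hypothesis h0_fixed : forall h, h \in h0 -> theta h = h.
Hypothesis h0_abelian : abelian_subspace br h0.

Local Open Scope complex_scope.
Local Open Scope sesquilinear_scope.

Local Notation cmx := (map_mx (real_complex R)).
Local Notation ad := (ad_mx br).
Local Notation B := (killing br).
Local Notation G := (gram (form_theta br theta)).

Let bl := form_theta_linl br_linl br_linr theta.
Let brr := form_theta_linr br_linl br_linr theta_cartan.
Let bC := form_thetaC br_linr theta_cartan.
Let bp := form_theta_gt0 theta_cartan.

Lemma codiagonalizable_ad (As : seq 'M[R[i]]_n) :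
  {in As, forall A, A *m cmx G = cmx G *m A ^t*} ->
  {in As &, forall A A', comm_mx A A'} ->
  exists2 P : 'M[R[i]]_n, P \in unitmx &
    {in As, forall A, exists2 d : 'rV[R[i]]_n,
       (forall j, d 0 j \is Num.real) & P *m A = diag_mx d *m P}.
Proof.
apply: selfadjoint_codiagonalizable; first by rewrite trC_cmx gram_sym.
exact: gram_gt0.
Qed.

(** Here ad x is symmetric, and nonzero since B(x, x) > 0. *)
Lemma noncompact_eigenvector x : theta x = - x -> x != 0 ->
  exists (s : R) (u : 'rV[R]_n), [/\ s != 0, u != 0 & br x u = s *: u].
Proof.
move=> xp x0.
have [||P Pu] := @codiagonalizable_ad [:: cmx (ad x)].
- move=> A; rewrite inE => /eqP ->; apply: (gram_sym_adj bl brr) => u w.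
  by rewrite !mul_ad //; exact: form_theta_sym.
- by move=> A A'; rewrite !inE => /eqP -> /eqP ->.
move=> /(_ _ (mem_head _ _))[d dreal PE].
have [d0|[j dj]] : d = 0 \/ exists j, d 0 j != 0.
  have [/existsP ?|/existsPn d0] := boolP [exists j, d 0 j != 0]; first by right.
  by left; apply/rowP => j; rewrite mxE; apply/eqP; have := d0 j; rewrite negbK.
  have adx0 : ad x = 0.
    apply: (map_mx_inj (f := real_complex R)).
    by apply: (can_inj (mulKmx Pu)); rewrite PE d0 map_mx0 mulmx0 linear0 mul0mx.
  have := form_theta_gt0 theta_cartan x0.
  by rewrite /form_theta /killing adx0 mul0mx mxtrace0 oppr0 ltxx.
have [s sE] := complex_realP _ (dreal j).
have s0 : s != 0 by apply: contra_neq dj => s0; rewrite sE s0.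
pose z := row j P.
have zE : z *m cmx (ad x) = s%:C *: z.
  by rewrite -row_mul PE row_mul row_diag_mx sE -scalemxAl -rowE.
have z0 : z != 0.
  apply/eqP => z0; have : row j (P *m invmx P) = 0 by rewrite row_mul -/z z0 mul0mx.
  by rewrite mulmxV // => /rowP/(_ j)/eqP; rewrite !mxE eqxx oner_eq0.
have [rE iE] : br x (re_part z) = s *: re_part z /\ br x (im_part z) = s *: im_part z.
  apply: cplx_inj; transitivity (z *m cmx (ad x)).
    by rewrite [in RHS](cplx_re_im z) mulmxDl -scalemxAl /cplx -!map_mxM !mul_ad.
  by rewrite zE [in LHS](cplx_re_im z) scalerDr /cplx !map_mxZ !scalerA mulrC.
have [r0|r0] := eqVneq (re_part z) 0; last by exists s, (re_part z).
exists s, (im_part z); split => //; apply: contra_neq z0 => i0.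
by rewrite (cplx_re_im z) r0 i0 /cplx map_mx0 scaler0 addr0.
Qed.

Local Notation V := (hR h0).

(** The matrix of the adjoint action of i h on the complexification. *)
Definition adC (h : V) : 'M[R[i]]_n := 'i *: cmx (ad (vsval h)).

Lemma cbr_toC h z : cbr br (toC h) z = z *m adC h.
Proof.
have reh : re_part (toC h) = 0 by apply/rowP => j; rewrite !mxE; simpc.
have imh : im_part (toC h) = vsval h by apply/rowP => j; rewrite !mxE; simpc.
rewrite /cbr reh imh !(br0l br_linl) sub0r add0r.
rewrite /adC {3}(cplx_re_im z) -scalemxAr mulmxDl -scalemxAl -!map_mxM !mul_ad //.
by rewrite scalerDr scalerA -expr2 sqr_i scaleN1r addrC /cplx map_mxN.
Qed.

Lemma ad_mx_toC h : ad_mx (cbr br) (toC h) = adC h.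
Proof. by apply/matrixP => i j; rewrite mxE cbr_toC -rowE mxE. Qed.

Lemma killing_toC (h h' : V) :
  killing (cbr br) (toC h) (toC h') = (- B (vsval h) (vsval h'))%:C.
Proof.
rewrite /killing !ad_mx_toC /adC -scalemxAl -scalemxAr scalerA -expr2 sqr_i.
by rewrite scaleN1r -map_mxM raddfN /= trace_map_mx rmorphN.
Qed.

(** The operators ad (i h) commute and are self-adjoint, so that they are
    simultaneously diagonalizable with real eigenvalues; each eigenvalue is
    linear in h because it is a diagonal entry in a fixed basis. *)
Lemma weight_basis : exists (P : 'M[R[i]]_n) (d : 'I_n -> hRdual h0),
  P \in unitmx /\ forall h j, row j P *m adC h = (d j h : R)%:C *: row j P.
Proof.
have adC_lin a h h' : adC (a *: h + h') = a%:C *: adC h + adC h'.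
  rewrite /adC linearP /= (ad_linear br_linl br_linr) map_mxD map_mxZ scalerDr.
  by rewrite !scalerA mulrC.
pose b (i : 'I_(\dim h0)) : V := vsproj h0 (vbasis h0)`_i.
have [||P Pu PE] := @codiagonalizable_ad [seq adC (b i) | i <- enum 'I_(\dim h0)].
- move=> _ /mapP[i _ ->]; apply: (gram_skew_adj bl brr) => u w.
  rewrite !mul_ad //; apply: form_theta_skew => //; exact/h0_fixed/subvsP.
- move=> _ _ /mapP[i _ ->] /mapP[j _ ->]; rewrite /comm_mx /adC.
  rewrite -!scalemxAl -!scalemxAr -!map_mxM; congr (_ *: (_ *: _)).
  congr (cmx _); apply/eqP; rewrite -subr_eq0 -(ad_br br_linr br_leibniz).
  rewrite h0_abelian ?subvsP //; apply/eqP.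
  by apply: row_eq_mx => u; rewrite mul_ad // (br0l br_linl) mulmx0.
pose r (j : 'I_n) (h : V) : R := complex.Re ((P *m adC h *m invmx P) j j).
have r_lin j : linear (r j : V -> R^o).
  move=> a h h'; rewrite /r adC_lin; move: (adC h) (adC h') => X Y.
  rewrite mulmxDr mulmxDl -scalemxAr -scalemxAl.
  move: (P *m X *m _) (P *m Y *m _) => X' Y'; rewrite [in LHS]mxE [in LHS]mxE.
  by case: (X' j j) (Y' j j) => x x' [y y']; simpc.
pose rL j : {linear V -> R^o} :=
  HB.pack (r j : V -> R^o) (GRing.isLinear.Build _ _ _ _ (r j : V -> R^o) (r_lin j)).
pose d j : hRdual h0 := linfun (rL j).
exists P, d; split => // h j.
have dE : d j h = r j h by rewrite lfunE.
have rowP0 : row j P *m invmx P = delta_mx 0 j.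
  by rewrite -row_mul mulmxV // rowE mulmx1.
suff [t tE] : exists t : R, row j P *m adC h = t%:C *: row j P.
  suff -> : (d j h : R) = t by [].
  rewrite dE /r; have -> : (P *m adC h *m invmx P) j j = (row j P *m adC h *m invmx P) 0 j.
    by rewrite -!row_mul [RHS]mxE.
  by rewrite tE -scalemxAl rowP0 !mxE !eqxx mulr1.
have : vsval h \in h0 := subvsP h.
move=> /coord_vbasis hE.
have {}hE : h = \sum_i coord (vbasis h0) i (vsval h) *: b i.
  apply: val_inj; rewrite /= [LHS]hE linear_sum; apply: eq_bigr => i _.
  rewrite linearZ /= /b vsprojK // vbasis_mem // mem_nth //.
  by rewrite size_tuple.
rewrite hE; elim/big_ind : _ => [|x y [t tE] [t' tE']|i _].
- by exists 0; rewrite scale0r /adC linear0 (_ : ad 0 = 0) ?map_mx0 ?scaler0 ?mulmx0 //;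
    apply: row_eq_mx => u; rewrite mul_ad // (br0l br_linl) mulmx0.
- exists (t + t'); have := adC_lin 1 x y; rewrite !scale1r => ->.
  by rewrite mulmxDr tE tE' -scalerDl -rmorphD.
- have [|e er eE] := PE (adC (b i)); first by apply: map_f; rewrite mem_enum.
  have [s sE] := complex_realP _ (er j).
  exists (coord (vbasis h0) i (vsval h) * s).
  have := adC_lin (coord (vbasis h0) i (vsval h)) (b i) 0.
  have -> : adC 0 = 0.
    by rewrite /adC linear0 (_ : ad 0 = 0) ?map_mx0 ?scaler0 //;
      apply: row_eq_mx => u; rewrite mul_ad // (br0l br_linl) mulmx0.
  rewrite !addr0 => ->; rewrite -scalemxAr -row_mul eE row_mul row_diag_mx.
  by rewrite -scalemxAl -rowE sE scalerA rmorphM.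
Qed.

End Weights.

Section Roots.
Variables (R : realType) (n : nat) (br : 'rV[R]_n -> 'rV[R]_n -> 'rV[R]_n).
Hypothesis br_linl : forall y, linear (br^~ y).
Hypothesis br_linr : forall x, linear (br x).
Hypothesis br_leibniz : forall u x y,
  br u (br x y) = br (br u x) y + br x (br u y).
Variable theta : 'End('rV[R]_n).
Hypothesis theta_cartan : cartan_involution br theta.
Variable h0 : {vspace 'rV[R]_n}.
Hypothesis h0_fixed : forall h, h \in h0 -> theta h = h.
Hypothesis h0_abelian : abelian_subspace br h0.

Local Open Scope complex_scope.

Local Notation B := (killing br).
Local Notation V := (hR h0).
Implicit Types phi psi alpha : hRdual h0.

Lemma killing_fixed_lt0 h : theta h = h -> h != 0 -> B h h < 0.
Proof.
by move=> hE h1; have := form_theta_gt0 theta_cartan h1; rewrite /form_theta hE oppr_gt0.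
Qed.

(** The Killing form is negative definite on h0, so Riesz representation shows
    that the vector selected in the definition of [hvec] exists. *)
Lemma hvecE phi (h : V) : (phi h : R) = - B (vsval (hvec br phi)) (vsval h).
Proof.
have : exists x : V, forall h : V, (phi h : R)%:C = killing (cbr br) (toC x) (toC h).
  have [||x y0|x xE] := @riesz_representation _ V
    (fun x y : V => - B (vsval x) (vsval y)) _ _ _ phi.
  - by move=> y a x x'; rewrite linearP /= killing_linl // opprD mulrN.
  - by move=> x a y y'; rewrite linearP /= killing_linr // opprD mulrN.
  - apply: val_inj => /=; apply/eqP; apply: contraT => x0.
    have := killing_fixed_lt0 (h0_fixed (subvsP x)) x0.
    by have /eqP := y0 x; rewrite oppr_eq0 => /eqP ->; rewrite ltxx.
  - by exists x => y; rewrite killing_toC // xE.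
move=> /(xgetPex 0) /(_ h) /=; rewrite -/(hvec br phi) killing_toC //.
by move=> /complexI.
Qed.

Lemma ipE phi psi : ip br phi psi = psi (hvec br phi).
Proof. by rewrite hvecE killingC /ip killing_toC. Qed.

Lemma ipC phi psi : ip br phi psi = ip br psi phi.
Proof. by rewrite ipE hvecE killingC ipE hvecE. Qed.

Lemma ip_linr phi : scalar (ip br phi).
Proof. by move=> a x y; rewrite !ipE add_lfunE scale_lfunE. Qed.

Lemma ip_gt0 phi : phi != 0 -> 0 < ip br phi phi.
Proof.
move=> phi0; rewrite ipE hvecE oppr_gt0; apply: killing_fixed_lt0.
  exact/h0_fixed/subvsP.
apply: contra_neq phi0 => v0; apply/lfunP => h.
by rewrite zero_lfunE; apply: etrans (hvecE _ _) _; rewrite v0 killingC killing0r // oppr0.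
Qed.

(** The last identity computes the trace of a product of two operators ad (i h)
    in a basis of weight vectors.  A root vector has a nonzero coordinate in that
    basis, so that every root is one of the d j; in particular there are finitely
    many roots. *)
Lemma weights : exists d : 'I_n -> hRdual h0,
  [/\ forall j, d j = 0 \/ Defs.roots br (d j),
      forall alpha, Defs.roots br alpha -> exists j, alpha = d j &
      forall phi psi, ip br phi psi = \sum_j ip br phi (d j) * ip br psi (d j)].
Proof.
have [P [d [Pu dP]]] :=
  weight_basis br_linl br_linr br_leibniz theta_cartan h0_fixed h0_abelian.
have PjV j : row j P *m invmx P = delta_mx 0 j.
  by rewrite -row_mul mulmxV // rowE mulmx1.
exists d; split.
- move=> j; have [->|dj] := eqVneq (d j) 0; [by left|right].
  split => //; exists (row j P); first by move=> h; rewrite cbr_toC // dP.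
  apply/eqP => r0; have := PjV j; rewrite r0 mul0mx.
  by move=> /rowP/(_ j)/eqP; rewrite !mxE !eqxx eq_sym oner_eq0.
- move=> alpha [_ [z zr z0]].
  have [j zj] : exists j, (z *m invmx P) 0 j != 0.
    apply/existsP; apply: contraNT z0 => /existsPn c0; apply/eqP.
    rewrite -[z](mulmxKV Pu) (_ : z *m invmx P = 0) ?mul0mx //.
    by apply/rowP => j; rewrite [RHS]mxE; apply/eqP; have := c0 j; rewrite negbK.
  exists j; apply/lfunP => h.
  have PD : P *m adC br h = diag_mx (\row_j (d j h : R)%:C) *m P.
    by apply/row_matrixP => i; rewrite !row_mul dP row_diag_mx mxE -scalemxAl -rowE.
  have := zr h; rewrite cbr_toC // -[z in LHS](mulmxKV Pu) -(mulmxA _ P) PD mulmxA.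
  move=> /(congr1 (mulmx^~ (invmx P))); rewrite mulmxK // -scalemxAl.
  move: (z *m invmx P) zj => c cj /rowP/(_ j).
  rewrite mul_mx_diag mxE [RHS]mxE mxE mulrC.
  by move=> /(mulIf cj)/complexI.
- move=> phi psi.
  have : killing (cbr br) (toC (hvec br phi)) (toC (hvec br psi)) =
      \sum_j (d j (hvec br phi) : R)%:C * (d j (hvec br psi) : R)%:C.
    rewrite /killing !ad_mx_toC //.
    set X := adC br _; set Y := adC br _.
    have -> : \tr (X *m Y) = \tr (P *m X *m Y *m invmx P).
      by rewrite -!mulmxA [RHS]mxtrace_mulC -!mulmxA mulVmx // mulmx1.
    apply: eq_bigr => j _.
    have -> : (P *m X *m Y *m invmx P) j j = (row j P *m X *m Y *m invmx P) 0 j.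
      by rewrite -!row_mul [RHS]mxE.
    by rewrite dP -!scalemxAl dP -scalemxAl PjV !mxE !eqxx mulr1.
  move=> e; rewrite [ip br phi psi]/ip e raddf_sum; apply: eq_bigr => j _.
  by rewrite -rmorphM /= !ipE.
Qed.

End Roots.

(** * Calculus of differentiable maps *)

Section Calculus.
Variables (R : realType).

Lemma near_eq_differentiable (V W : normedModType R) (f g : V -> W) (a : V) :
  (\near a, f a = g a) -> differentiable f a -> differentiable g a.
Proof.
move=> fg df; have fga : f a = g a := nbhs_singleton fg.
have [dfc dfE] := (diff_locallyP _ _).1 df.
have dgE : g \o shift a = cst (g a) + 'd f a +o_ 0 id.
  apply/eqaddoP => eps eps0.
  have /eqaddoP/(_ eps eps0) H := dfE.
  have fg0 : \forall h \near (0 : V), f (h + a) = g (h + a).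
    by move: fg; rewrite (near_shift 0) subr0.
  near=> h; have : f (h + a) = g (h + a) by near: h.
  have : `|(f \o shift a - (cst (f a) + 'd f a)) h| <= eps * `|id h| by near: h.
  by rewrite /= !fctE /= => + <-; rewrite fga.
by apply/diff_locallyP; rewrite (diff_unique dfc dgE).
Unshelve. all: by end_near. Qed.

(** The definition of the differential as an estimate, the remainder being small
    uniformly in the direction y - a. *)
Lemma differentiable_approx (V W : normedModType R) (f : V -> W) (a : V) eps :
  differentiable f a -> 0 < eps ->
  \forall y \near a, `|f y - f a - 'D_(y - a) f a| <= eps * `|y - a|.
Proof.
move=> df eps0; have [dfc dfE] := (diff_locallyP _ _).1 df.
have /eqaddoP/(_ eps eps0) := dfE.
move=> H; rewrite (near_shift (0 : V) a); apply: filterS H => y.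
by rewrite /= !fctE /= subr0 addrK deriveE // opprD addrA.
Qed.

Lemma smooth_on_differentiable (V W : normedModType R) (U : set V) (f : V -> W) x :
  smooth_on U f -> U x -> differentiable f x.
Proof. by move=> [_ /(_ 1%N)[+ _]] Ux; apply; rewrite inE. Qed.

Lemma smooth_on_derive_differentiable (V W : normedModType R) (U : set V)
    (f : V -> W) v x :
  smooth_on U f -> U x -> differentiable (fun y => 'D_v f y) x.
Proof. by move=> [_ /(_ 2%N)[_ /(_ v)[+ _]]] Ux; apply; rewrite inE. Qed.

Lemma deriveDv (V W : normedModType R) (f : V -> W) a u v r :
  differentiable f a -> 'D_(r *: u + v) f a = r *: 'D_u f a + 'D_v f a.
Proof. by move=> df; rewrite !deriveE // linearP. Qed.

Lemma derive_comp (U V W : normedModType R) (f : U -> V) (g : V -> W) a v :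
  differentiable f a -> differentiable g (f a) ->
  'D_v (g \o f) a = 'D_('D_v f a) g (f a).
Proof.
by move=> df dg; rewrite !deriveE //; [rewrite diff_comp | exact: differentiable_comp].
Qed.

Lemma derive_sumZ (V W : normedModType R) (I : Type) (r : seq I)
    (k : I -> V -> R) (w : I -> W) x v :
  (forall i, differentiable (k i) x) ->
  differentiable (fun y => \sum_(i <- r) k i y *: w i) x /\
  'D_v (fun y => \sum_(i <- r) k i y *: w i) x = \sum_(i <- r) 'D_v (k i) x *: w i.
Proof.
move=> dk; elim: r => [|i r [IH1 IH2]].
  have -> : (fun y => \sum_(i <- [::]) k i y *: w i) = cst 0.
    by apply/funext => y; rewrite big_nil.
  by rewrite big_nil derive_cst; split => //; exact: differentiable_cst.
have -> : (fun y => \sum_(i0 <- i :: r) k i0 y *: w i0) =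
    (fun y => k i y *: w i) + (fun y => \sum_(i0 <- r) k i0 y *: w i0).
  by apply/funext => y; rewrite big_cons.
have dki := differentiableZl (w i) (dk i).
split; first exact: differentiableD.
rewrite big_cons (deriveD (diff_derivable dki) (diff_derivable IH1)) IH2.
by congr (_ + _); rewrite (deriveE v dki) (diffZl _ (dk i)) (deriveE v (dk i)).
Qed.

Lemma differentiable_entry (V : normedModType R) m n (f : V -> 'M[R]_(m, n)) x i j :
  differentiable f x -> differentiable (fun y => f y i j : R) x.
Proof.
move=> df.
exact: (@differentiable_comp _ _ _ _ f (fun N : 'M[R]_(m, n) => N i j : R) x df
  (differentiable_coord _ _ _)).
Qed.

Lemma derive_entry (V : normedModType R) m n (f : V -> 'M[R]_(m, n)) x v i j :
  differentiable f x -> 'D_v (fun y => f y i j : R) x = 'D_v f x i j.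
Proof. by move=> df; rewrite derive_mx ?mxE //; exact: diff_derivable. Qed.

Lemma bilinear_sum m n p (b : 'rV[R]_m -> 'rV[R]_n -> 'rV[R]_p) u v :
  (forall y, linear (b^~ y)) -> (forall x, linear (b x)) ->
  b u v = \sum_(ij : 'I_m * 'I_n) (u 0 ij.1 * v 0 ij.2) *:
     b (delta_mx 0 ij.1) (delta_mx 0 ij.2).
Proof.
move=> bl br.
pose bL y : {linear 'rV[R]_m -> 'rV[R]_p} :=
  HB.pack (b^~ y) (GRing.isLinear.Build _ _ _ _ (b^~ y) (bl y)).
pose bR x : {linear 'rV[R]_n -> 'rV[R]_p} :=
  HB.pack (b x) (GRing.isLinear.Build _ _ _ _ (b x) (br x)).
rewrite -(pair_bigA _ (fun i j => (u 0 i * v 0 j) *: b (delta_mx 0 i) (delta_mx 0 j))) /=.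
rewrite -[b u v]/(bL v u) {1}(row_sum_delta u) linear_sum; apply: eq_bigr => i _.
rewrite linearZ /= -[b _ v]/(bR _ v) {1}(row_sum_delta v) linear_sum scaler_sumr.
by apply: eq_bigr => j _; rewrite linearZ /= scalerA.
Qed.

Lemma derive_bilinear (V : normedModType R) m n p
    (b : 'rV[R]_m -> 'rV[R]_n -> 'rV[R]_p) (f : V -> 'rV[R]_m) (g : V -> 'rV[R]_n) x v :
  (forall y, linear (b^~ y)) -> (forall x, linear (b x)) ->
  differentiable f x -> differentiable g x ->
  differentiable (fun y => b (f y) (g y)) x /\
  'D_v (fun y => b (f y) (g y)) x = b ('D_v f x) (g x) + b (f x) ('D_v g x).
Proof.
move=> bl br df dg.
have -> : (fun y => b (f y) (g y)) = (fun y => \sum_(ij : 'I_m * 'I_n)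
    (f y 0 ij.1 * g y 0 ij.2) *: b (delta_mx 0 ij.1) (delta_mx 0 ij.2)).
  by apply/funext => y; exact: bilinear_sum.
have dfi i := differentiable_entry 0 i df.
have dgi i := differentiable_entry 0 i dg.
have [|h1 ->] := @derive_sumZ V _ _ (index_enum _)
  (fun ij y => f y 0 ij.1 * g y 0 ij.2) (fun ij => b (delta_mx 0 ij.1) (delta_mx 0 ij.2)) x v.
  by move=> ij; exact: differentiableM.
split => //.
rewrite (bilinear_sum _ _ bl br) (bilinear_sum (f x) _ bl br) -big_split /=.
apply: eq_bigr => -[i j] _ /=; rewrite -scalerDl; congr (_ *: _).
rewrite deriveM; [|exact: diff_derivable..].
by rewrite !derive_entry //= addrC [g x 0 j *: _]mulrC.
Qed.

End Calculus.

(** * The adjoint representation *)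

Section LieGroup.
Variables (R : realType) (n : nat) (G : lieGroupType R n).

Section Chart.
Variable d : chart R n G.

Lemma cinvK x : cim d x -> cmap d (cinv d x) = x.
Proof. by move=> [g dg <-]; rewrite cmapK // inE. Qed.

Lemma cinv_dom x : cim d x -> cdom d (cinv d x).
Proof. by move=> [g dg <-]; rewrite cmapK // inE. Qed.

Lemma cmapKd g : cdom d g -> cinv d (cmap d g) = g.
Proof. by move=> dg; rewrite cmapK // inE. Qed.

Lemma cim_cmap g : cdom d g -> cim d (cmap d g).
Proof. by move=> dg; exists g. Qed.

Lemma near_cim x : cim d x -> \forall y \near x, cim d y.
Proof. by move=> dx; apply: open_nbhs_nbhs; split => //; exact: cim_open. Qed.

Lemma near_cdom g : cdom d g -> \forall h \near g, cdom d h.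
Proof. by move=> dx; apply: open_nbhs_nbhs; split => //; exact: cdom_open. Qed.

Lemma cinv_cvg x : cim d x -> cinv d @ x --> cinv d x.
Proof. by move=> dx; apply: (cinv_continuous (c := d)); rewrite inE. Qed.

Lemma cmap_cvg g : cdom d g -> cmap d @ g --> cmap d g.
Proof. by move=> dg; apply: (cmap_continuous (c := d)); rewrite inE. Qed.

End Chart.

Lemma mulg_cvg (T : Type) (F : set_system T) {FF : Filter F} (f g : T -> G) a b :
  f @ F --> a -> g @ F --> b -> (fun x => f x * g x)%g @ F --> (a * b)%g.
Proof. by move=> fa gb; apply: continuous2_cvg fa gb; exact: (mulg_continuous (a, b)). Qed.

Lemma invg_cvg (T : Type) (F : set_system T) {FF : Filter F} (f : T -> G) a :
  f @ F --> a -> (fun x => (f x)^-1)%g @ F --> (a^-1)%g.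
Proof. by move=> fa; apply: cvg_comp fa _; exact: (invg_continuous a). Qed.

Lemma exists_chart (g : G) : exists2 a : chart R n G, atlas a & cdom a g.
Proof.
have : [set: G] g by [].
by rewrite -(@atlas_cover R n G) => -[a aa ag]; exists a.
Qed.

Variable c : chart R n G.
Hypothesis c_atlas : atlas c.
Hypothesis c_unit : cdom c 1%g.

Local Notation e := (cmap c 1%g).

Lemma cinv_e : cinv c e = 1%g. Proof. exact: cmapKd. Qed.

Lemma cim_e : cim c e. Proof. exact: cim_cmap. Qed.

Lemma cinv_cvg1 : cinv c @ e --> (1%g : G).
Proof. by rewrite -{2}cinv_e; apply: cinv_cvg cim_e. Qed.

(** Its differential at e is [Ad c g]. *)
Definition chart_conj (g : G) (x : 'rV[R]_n) : 'rV[R]_n := cmap c (g * cinv c x * g^-1)%g.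

Lemma chart_conj_e g : chart_conj g e = e.
Proof. by rewrite /chart_conj cinv_e mulg1 mulgV. Qed.

Lemma conj_cvg g : (fun x => g * cinv c x * g^-1)%g @ e --> (1%g : G).
Proof.
have h (t : G) : (fun=> t) @ e --> t by exact: (@cvg_cst G t _ (nbhs e) _).
have := @mulg_cvg _ (nbhs e) _ _ _ _ _
  (@mulg_cvg _ (nbhs e) _ _ _ _ _ (h g) cinv_cvg1) (h g^-1%g).
by rewrite mulg1 mulgV; apply.
Qed.

Lemma near_conj_dom g : \forall x \near e, cdom c (g * cinv c x * g^-1)%g.
Proof. exact: (@conj_cvg g _ (near_cdom c_unit)). Qed.

(** The element g need not lie in the domain of c: conjugation by g is the
    composite of x |-> g x and y |-> y g^-1, read in charts around g and g^-1. *)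
Lemma differentiable_chart_conj g : differentiable (chart_conj g) e.
Proof.
have [a aa ag] := exists_chart g.
have [b ba bg] := exists_chart g^-1%g.
pose f1 x := cmap a (cinv a (cmap a g) * cinv c x)%g.
pose f2 y := cmap c (cinv a y * cinv b (cmap b g^-1))%g.
have f1e : f1 e = cmap a g by rewrite /f1 cmapKd // cinv_e mulg1.
have df1 : differentiable f1 e.
  pose m z := cmap a (cinv a z.1 * cinv c z.2)%g.
  apply: (@differentiable_comp _ _ _ _ (fun x => (cmap a g, x)) m e).
    by apply: differentiable_pair.
  apply: (smooth_on_differentiable (mulg_smooth _ _ _ aa c_atlas aa)).
  split; [exact: cim_cmap|exact: cim_e|].
  by rewrite /= cmapKd // cinv_e mulg1.
have df2 : differentiable f2 (f1 e).
  pose m z := cmap c (cinv a z.1 * cinv b z.2)%g.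
  rewrite f1e.
  apply: (@differentiable_comp _ _ _ _ (fun y => (y, cmap b g^-1%g)) m (cmap a g)).
    by apply: differentiable_pair.
  apply: (smooth_on_differentiable (mulg_smooth _ _ _ aa ba c_atlas)).
  split; [exact: cim_cmap|exact: cim_cmap|].
  by rewrite /= !cmapKd // mulgV.
apply: (@near_eq_differentiable _ _ _ (f2 \o f1)); last exact: differentiable_comp.
have near_a : \forall x \near e, cdom a (g * cinv c x)%g.
  have h : (fun x => g * cinv c x)%g @ e --> g.
    have h (t : G) : (fun=> t) @ e --> t by exact: (@cvg_cst G t _ (nbhs e) _).
    by have := @mulg_cvg _ (nbhs e) _ _ _ _ _ (h g) cinv_cvg1; rewrite mulg1; apply.
  exact: (h _ (near_cdom ag)).
apply: filterS near_a => x xa.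
by rewrite /= /f2 /f1 (cmapKd ag) (cmapKd xa) (cmapKd bg).
Qed.

Lemma AdE g v : Ad c g v = 'D_v (chart_conj g) e. Proof. by []. Qed.

Lemma Ad_linear g : linear (Ad c g).
Proof. by move=> r u v; rewrite !AdE deriveDv //; exact: differentiable_chart_conj. Qed.

Lemma AdM g h v : Ad c (g * h)%g v = Ad c g (Ad c h v).
Proof.
rewrite !AdE -{2}(chart_conj_e h) -derive_comp ?chart_conj_e; [|exact: differentiable_chart_conj..].
apply: near_eq_derive; apply: filterS (near_conj_dom h) => x xh.
by rewrite /= /chart_conj (cmapKd xh) invgM !mulgA.
Qed.

Lemma Ad1 v : Ad c 1%g v = v.
Proof.
rewrite AdE -[RHS](derive_id e v); apply: near_eq_derive.
by apply: filterS (near_cim cim_e) => x xc; rewrite /chart_conj mul1g invg1 mulg1 cinvK.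
Qed.

End LieGroup.

Section AdSmooth.
Variables (R : realType) (n : nat) (G : lieGroupType R n).
Variable c : chart R n G.
Hypothesis c_atlas : atlas c.
Hypothesis c_unit : cdom c 1%g.

Local Notation e := (cmap c 1%g).
Local Notation V := 'rV[R]_n.

Let cim_e : cim c e. Proof. exact: cim_e. Qed.
Let cinv_e : cinv c e = 1%g. Proof. exact: cinv_e. Qed.

Definition chart_mul (z : V * V) : V := cmap c (cinv c z.1 * cinv c z.2)%g.
Definition chart_inv (x : V) : V := cmap c (cinv c x)^-1%g.

Definition chart_mul_dom : set (V * V) :=
  [set z | [/\ cim c z.1, cim c z.2 & cdom c (cinv c z.1 * cinv c z.2)%g]].

Lemma chart_mul_smooth : smooth_on chart_mul_dom chart_mul.
Proof. exact: mulg_smooth. Qed.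

Lemma near_chart_inv : \forall x \near e, cim c x /\ cdom c (cinv c x)^-1%g.
Proof.
apply: filterI; first exact: near_cim.
have h : (fun x => (cinv c x)^-1)%g @ e --> (1%g : G).
  by have := @invg_cvg _ _ G _ (nbhs e) _ _ _ (cinv_cvg1 c_unit); rewrite invg1; apply.
exact: (h _ (near_cdom c_unit)).
Qed.

Lemma chart_mul_dom_e x : cim c x -> chart_mul_dom (x, e).
Proof. by move=> cx; split => //=; rewrite cinv_e mulg1; exact: cinv_dom. Qed.

Lemma chart_mul_dom_inv x : cim c x -> cdom c (cinv c x)^-1%g -> chart_mul_dom (x, chart_inv x).
Proof.
move=> cx cx'; split => //=; first exact: cim_cmap.
by rewrite /chart_inv cmapKd // mulgV.
Qed.

Lemma derive_insl (x y v : V) : 'D_v (fun x : V => (x, y)) x = (v, 0 : V).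
Proof.
have -> : (fun x : V => (x, y)) = (fun x : V => (id x, cst y x)) by [].
have di : differentiable (id : V -> V) x by [].
have dc : differentiable (cst y : V -> V) x by [].
rewrite (deriveE v (differentiable_pair di dc)) (diff_pair di dc).
congr (_, _).
  exact: (etrans (esym (deriveE v di)) (derive_id x v)).
exact: (etrans (esym (deriveE v dc)) (derive_cst y x v)).
Qed.

Lemma derive_insr (x y v : V) : 'D_v (fun y : V => (x, y)) y = (0 : V, v).
Proof.
have -> : (fun y : V => (x, y)) = (fun y : V => (cst x y, id y)) by [].
have di : differentiable (id : V -> V) y by [].
have dc : differentiable (cst x : V -> V) y by [].
rewrite (deriveE v (differentiable_pair dc di)) (diff_pair dc di).
congr (_, _).
  exact: (etrans (esym (deriveE v dc)) (derive_cst x y v)).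
exact: (etrans (esym (deriveE v di)) (derive_id y v)).
Qed.

Lemma derive_pairl (f : V * V -> V) x y v : differentiable f (x, y) ->
  'D_v (fun x => f (x, y)) x = 'D_(v, 0) f (x, y).
Proof.
move=> df.
have dp : differentiable (fun x : V => (x, y)) x by exact: differentiable_pair.
transitivity ('D_('D_v (fun x : V => (x, y)) x) f (x, y)).
  exact: (derive_comp v dp df).
by rewrite derive_insl.
Qed.

Lemma derive_pairr (f : V * V -> V) x y v : differentiable f (x, y) ->
  'D_v (fun y => f (x, y)) y = 'D_(0, v) f (x, y).
Proof.
move=> df.
have dp : differentiable (fun y : V => (x, y)) y by exact: differentiable_pair.
transitivity ('D_('D_v (fun y : V => (x, y)) y) f (x, y)).
  exact: (derive_comp v dp df).
by rewrite derive_insr.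
Qed.

(** In the chart, conjugation by the element of coordinates x is the map
    y |-> (x y) x^-1; the chain rule at the unit expresses its differential by
    partial derivatives of the multiplication at (x, e) and (x, x^-1). *)
Lemma Ad_cinvE v : \forall x \near e, Ad c (cinv c x) v =
  \sum_i ('D_(0, v) chart_mul (x, e)) 0 i *: 'D_(delta_mx 0 i, 0) chart_mul (x, chart_inv x).
Proof.
apply: filterS near_chart_inv => x [cx cx'].
have dxe := smooth_on_differentiable chart_mul_smooth (chart_mul_dom_e cx).
have dxi := smooth_on_differentiable chart_mul_smooth (chart_mul_dom_inv cx cx').
have mxe : chart_mul (x, e) = x by rewrite /chart_mul /= cinv_e mulg1 cinvK.
have df : differentiable (fun y => chart_mul (x, y)) e.
  by apply: (differentiable_comp (f := fun y : V => (x, y))) => //;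
    exact: differentiable_pair.
have dg : differentiable (fun q => chart_mul (q, chart_inv x)) (chart_mul (x, e)).
  rewrite mxe.
  by apply: (differentiable_comp (f := fun q : V => (q, chart_inv x))) => //;
    exact: differentiable_pair.
have -> : Ad c (cinv c x) v =
    'D_v ((fun q => chart_mul (q, chart_inv x)) \o (fun y => chart_mul (x, y))) e.
  apply: near_eq_derive.
  have h : (fun y => cinv c x * cinv c y)%g @ e --> (cinv c x).
    have := @mulg_cvg _ _ G _ (nbhs e) _ _ _ _ _
      (@cvg_cst G (cinv c x) _ (nbhs e) _) (cinv_cvg1 c_unit).
    by rewrite mulg1; apply.
  have xd : \forall y \near e, cdom c (cinv c x * cinv c y)%g.
    exact: (h _ (near_cdom (cinv_dom cx))).
  apply: filterS xd => y xy.
  by rewrite /= /chart_mul /= (cmapKd xy) /chart_inv (cmapKd cx').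
rewrite (derive_comp v df dg) (derive_pairr v dxe) mxe (derive_pairl _ dxi).
apply: (linear_row_sum (f := fun w => 'D_(w, 0) chart_mul (x, chart_inv x))) => r u w.
transitivity ('D_(r *: (u, 0 : V) + (w, 0 : V)) chart_mul (x, chart_inv x));
  last exact: deriveDv.
congr (derive chart_mul _ _); apply/eqP; rewrite xpair_eqE /=.
by rewrite [X in _ && (_ == X + _)]scaler0 addr0 !eqxx.
Qed.

(** By [Ad_cinvE] the map is a sum of products of first partial derivatives of the
    multiplication, which is smooth. *)
Lemma differentiable_Ad v : differentiable (fun x => Ad c (cinv c x) v) e.
Proof.
have dI : differentiable chart_inv e.
  by apply: (smooth_on_differentiable (invg_smooth _ _ c_atlas c_atlas));
    exact: (nbhs_singleton near_chart_inv).
pose W x := 'D_(0, v) chart_mul (x, e).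
pose F i x := 'D_(delta_mx 0 i, 0) chart_mul (x, chart_inv x).
have dW : differentiable W e.
  apply: (@differentiable_comp _ _ _ _ (fun x => (x, e)) (fun z => 'D_(0, v) chart_mul z)).
    exact: differentiable_pair.
  exact: smooth_on_derive_differentiable chart_mul_smooth (chart_mul_dom_e _).
have dF i : differentiable (F i) e.
  apply: (@differentiable_comp _ _ _ _ (fun x => (x, chart_inv x))
    (fun z => 'D_(delta_mx 0 i, 0) chart_mul z)).
    exact: differentiable_pair.
  apply: smooth_on_derive_differentiable chart_mul_smooth _.
  by have [? ?] := nbhs_singleton near_chart_inv; exact: chart_mul_dom_inv.
have [dS _] := @derive_sumZ R V V _ (index_enum _)
  (fun (ij : 'I_n * 'I_n) x => W x 0 ij.1 * F ij.1 x 0 ij.2) (fun ij => delta_mx 0 ij.2) e 0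
  (fun ij => differentiableM (differentiable_entry 0 ij.1 dW)
    (differentiable_entry 0 ij.2 (dF ij.1))).
apply: near_eq_differentiable dS.
apply: filterS (Ad_cinvE v) => x ->.
rewrite -(pair_bigA _ (fun i j => (W x 0 i * F i x 0 j) *: delta_mx 0 j)) /=.
apply: eq_bigr => i _; rewrite -[in RHS]/(W x) -[in RHS]/(F i x).
rewrite [F i x in RHS]row_sum_delta scaler_sumr.
by apply: eq_bigr => j _; rewrite scalerA.
Qed.

Lemma lie_bracket_linl v : linear (fun u => lie_bracket c u v).
Proof. by move=> r u w; rewrite /lie_bracket deriveDv //; exact: differentiable_Ad. Qed.

Lemma lie_bracket_linr u : linear (lie_bracket c u).
Proof.
move=> r v w; rewrite /lie_bracket.
have dv := differentiable_Ad v; have dw := differentiable_Ad w.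
have -> : (fun x => Ad c (cinv c x) (r *: v + w)) =
    (r \*: (fun x => Ad c (cinv c x) v)) + (fun x => Ad c (cinv c x) w).
  by apply/funext => x; rewrite Ad_linear.
rewrite deriveD; [|exact/derivableZ/diff_derivable|exact/diff_derivable].
by rewrite deriveZ //; exact/diff_derivable.
Qed.

(** Ad g transports x |-> Ad x to its conjugate by g, whose differential at the
    unit is the bracket precomposed with Ad g. *)
Lemma Ad_bracket g u v :
  Ad c g (lie_bracket c u v) = lie_bracket c (Ad c g u) (Ad c g v).
Proof.
rewrite /lie_bracket -[in RHS](chart_conj_e c_unit g) [Ad c g u]AdE.
have dK := differentiable_chart_conj c_atlas c_unit g.
rewrite -[in LHS](derive_id e u) -derive_comp ?chart_conj_e //; last exact: differentiable_Ad.
have -> : Ad c g ('D_('D_u id e) (fun x => Ad c (cinv c x) v) e) =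
    'D_u (fun x => Ad c g (Ad c (cinv c x) v)) e.
  rewrite derive_id [LHS](linear_row_sum _ (Ad_linear c_atlas c_unit g)).
  have dA := differentiable_Ad v.
  have -> : (fun x => Ad c g (Ad c (cinv c x) v)) =
      (fun x => \sum_i (Ad c (cinv c x) v) 0 i *: Ad c g (delta_mx 0 i)).
    by apply/funext => x; exact: (linear_row_sum _ (Ad_linear c_atlas c_unit g)).
  have [_ ->] := @derive_sumZ R V V _ (index_enum _)
    (fun i x => (Ad c (cinv c x) v) 0 i) (fun i => Ad c g (delta_mx 0 i)) e u
    (fun i => differentiable_entry 0 i dA).
  by apply: eq_bigr => i _; rewrite derive_entry.
apply: near_eq_derive; apply: filterS (near_conj_dom c_unit g) => x xg.
rewrite /= /chart_conj (cmapKd xg) !(AdM c_atlas c_unit).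
by rewrite -(AdM c_atlas c_unit (g^-1)%g) mulVg Ad1.
Qed.

(** Differentiate Ad z [x, y] = [Ad z x, Ad z y] at the unit along u. *)
Lemma lie_bracket_leibniz u x y : lie_bracket c u (lie_bracket c x y) =
  lie_bracket c (lie_bracket c u x) y + lie_bracket c x (lie_bracket c u y).
Proof.
rewrite {1}/lie_bracket.
have -> : (fun z => Ad c (cinv c z) (lie_bracket c x y)) =
    (fun z => lie_bracket c (Ad c (cinv c z) x) (Ad c (cinv c z) y)).
  by apply/funext => z; exact: Ad_bracket.
have [_ ->] := derive_bilinear u lie_bracket_linl lie_bracket_linr
  (differentiable_Ad x) (differentiable_Ad y).
by rewrite !cinv_e !Ad1.
Qed.

End AdSmooth.

(** * Powers of operators close to the identity *)

Lemma bernoulli_le (R : realFieldType) (s : R) j : 0 <= s -> 1 + s * j%:R <= (1 + s) ^+ j.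
Proof.
move=> s0; elim: j => [|j IH]; first by rewrite mulr0 addr0 expr0.
rewrite exprS mulrDl mul1r -natr1 mulrDr mulr1 addrA lerD // ler_peMr //.
by rewrite exprn_ege1 // lerDl.
Qed.

Section NearIdentity.
Variables (R : realFieldType) (V : normedModType R) (f : V -> V).
Variable a : R.
Hypothesis f_near : forall w, `|f w - w| <= a * `|w|.

(** One more application of f adds at most a |f^j w| to the deviation, and
    |f^j w| <= 2 |w| as long as the deviation is at most |w|. *)
Lemma iter_near_id j w : 0 <= a -> 2 * a * j%:R <= 1 ->
  `|iter j f w - w| <= 2 * a * j%:R * `|w|.
Proof.
move=> a0; elim: j => [|j IH] h; first by rewrite /= subrr normr0 mulr0 mul0r.
have j0 : 0 <= j%:R :> R by [].
rewrite -natr1 in h *.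
have h' : 2 * a * j%:R <= 1 by nra.
have := IH h'; set D := `|_ - w| => IHj.
have w0 : 0 <= `|w| by [].
have fj : `|iter j f w| <= D + `|w| by rewrite -{1}[iter j f w](subrK w) ler_normD.
have aux : `|f (iter j f w) - w| <= a * `|iter j f w| + D.
  by rewrite -(subrKA (iter j f w)) (le_trans (ler_normD _ _)) // lerD.
rewrite iterS (le_trans aux) //.
have : a * `|iter j f w| <= a * (2 * `|w|).
  rewrite ler_wpM2l // (le_trans fj) //.
  have : 2 * a * j%:R * `|w| <= 1 * `|w| by rewrite ler_wpM2r.
  lra.
lra.
Qed.

(** If u is almost an eigenvector for 1 + s then the powers of f applied to u
    stay close to the powers of 1 + s. *)
Lemma iter_near_eigen (f_lin : linear f) u s eta j :
  0 <= a -> 0 <= s -> 2 * a * j%:R <= 1 -> 2 * s * j%:R <= 1 ->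
  `|f u - (1 + s) *: u| <= eta ->
  `|iter j f u - (1 + s) ^+ j *: u| <= 4 * j%:R * eta.
Proof.
move=> a0 s0 + + fu; have eta0 : 0 <= eta by apply: le_trans fu.
elim: j => [|j IH] ha hs.
  by rewrite /= expr0 scale1r subrr normr0 mulr0 mul0r.
have j0 : 0 <= j%:R :> R by [].
rewrite -natr1 in ha hs *.
have ha' : 2 * a * j%:R <= 1 by nra.
have hs' : 2 * s * j%:R <= 1 by nra.
have := IH ha' hs'; set D := iter j f u - _ => IHj.
have flj : linear (iter j f).
  elim: j {IH j0 ha hs ha' hs' D IHj} => [|j IH] r x y //=.
  by rewrite IH f_lin.
have -> : iter j.+1 f u - (1 + s) ^+ j.+1 *: u =
    iter j f (f u - (1 + s) *: u) + (1 + s) *: D.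
  rewrite iterSr -[f u in LHS](subrK ((1 + s) *: u)).
  have E x : iter j f (x + (1 + s) *: u) = iter j f x + (1 + s) *: iter j f u.
    by rewrite [x + _]addrC flj [RHS]addrC.
  by rewrite E /D scalerBr scalerA -exprS addrA.
rewrite (le_trans (ler_normD _ _)) //.
set err := f u - _ in fu *.
have e1 : `|iter j f err| <= 2 * eta.
  have := iter_near_id err a0 ha'.
  have : `|iter j f err| <= `|iter j f err - err| + `|err|.
    by rewrite -{1}[iter j f err](subrK err) ler_normD.
  have : 2 * a * j%:R * `|err| <= 1 * `|err| by rewrite ler_wpM2r.
  lra.
have e2 : `|(1 + s) *: D| <= (1 + s) * (4 * j%:R * eta).
  by rewrite normrZ ger0_norm ?addr_ge0 // ler_wpM2l ?addr_ge0.
have : 2 * s * j%:R * eta <= 1 * eta by rewrite ler_wpM2r.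
lra.
Qed.

End NearIdentity.

Section Norms.
Variable R : realType.

Lemma entry_le_norm m n (M : 'M[R]_(m, n)) i j : `|M i j| <= `|M|.
Proof.
rewrite [leRHS]/Num.Def.normr /= mx_normrE.
exact: (le_bigmax _ (fun ij : 'I_m * 'I_n => `|M ij.1 ij.2|) (i, j)).
Qed.

Lemma norm_le_entries m n (M : 'M[R]_(m, n)) t :
  0 <= t -> (forall i j, `|M i j| <= t) -> `|M| <= t.
Proof.
move=> t0 Mt; rewrite /Num.Def.normr /= mx_normrE.
by apply: bigmax_le => // -[i j] _; exact: Mt.
Qed.

Lemma linear_norm_le n (W : normedModType R) (f : 'rV[R]_n -> W) t w :
  linear f -> (forall i, `|f (delta_mx 0 i)| <= t) -> `|f w| <= n%:R * t * `|w|.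
Proof.
move=> flin ft; rewrite (linear_row_sum w flin) (le_trans (ler_norm_sum _ _ _)) //.
apply: (@le_trans _ _ (\sum_(i < n) t * `|w|)).
  apply: ler_sum => i _; rewrite normrZ mulrC ler_pM //; exact: entry_le_norm.
by rewrite sumr_const card_ord -[leLHS]mulr_natl mulrA.
Qed.

Lemma linear_bounded n (W : normedModType R) (f : 'rV[R]_n -> W) :
  linear f -> exists2 t, 0 < t & forall w, `|f w| <= t * `|w|.
Proof.
move=> flin; pose s := \sum_i `|f (delta_mx 0 i)|.
have s0 : 0 <= s by exact: sumr_ge0.
exists (n%:R * s + 1) => [|w]; first by rewrite ltr_wpDl // mulr_ge0.
rewrite mulrDl mul1r (le_trans (linear_norm_le w flin (t := s) _)) ?lerDl // => i.
by rewrite /s (bigD1 i) //= lerDl sumr_ge0.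
Qed.

End Norms.

(** * Estimates for Ad near the unit *)

Section Estimates.
Variables (R : realType) (n : nat).
Local Notation V := 'rV[R]_n.
Variable br : V -> V -> V.
Hypothesis br_linl : forall y, linear (br^~ y).
Hypothesis br_linr : forall x, linear (br x).
Hypothesis br_semisimple : semisimple br.

Lemma bracket_bounded : exists2 M, 0 < M & forall z w, `|br z w| <= M * `|z| * `|w|.
Proof.
pose s := \sum_(i < n) \sum_(j < n) `|br (delta_mx 0 i) (delta_mx 0 j)|.
have s0 : 0 <= s by apply: sumr_ge0 => i _; exact: sumr_ge0.
have n0 : 0 <= n%:R * n%:R :> R by exact: mulr_ge0.
exists (n%:R * n%:R * s + 1) => [|z w]; first by rewrite ltr_wpDl // mulr_ge0.
have H : `|br z w| <= n%:R * (n%:R * s * `|w|) * `|z|.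
  apply: (linear_norm_le (f := br^~ w)) => // i.
  apply: linear_norm_le => // j.
  rewrite /s (bigD1 i) //= (bigD1 j) //= -addrA lerDl addr_ge0 ?sumr_ge0 // => k _.
  exact: sumr_ge0.
rewrite (le_trans H) // mulrDl mul1r mulrDl.
have -> : n%:R * (n%:R * s * `|w|) * `|z| = n%:R * n%:R * s * `|z| * `|w| by ring.
by rewrite lerDl mulr_ge0.
Qed.

(** Such a z lies in the radical of the Killing form. *)
Lemma bracket_nondegenerate z : (forall w, br z w = 0) -> z = 0.
Proof.
move=> z0; apply: br_semisimple => w; rewrite /killing.
have -> : ad_mx br z = 0.
  by apply: row_eq_mx => u; rewrite (mul_ad br_linr) z0 mulmx0.
by rewrite mul0mx mxtrace0.
Qed.

(** The adjoint representation is injective with values in a finite-dimensional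
    space, so it has a bounded left inverse. *)
Lemma bracket_lower_bound : exists2 K, 0 < K & forall z t, 0 <= t ->
  (forall w, `|br z w| <= t * `|w|) -> `|z| <= K * t.
Proof.
pose L z := mxvec (ad_mx br z).
have Llin : linear L by move=> r u v; rewrite /L (ad_linear br_linl br_linr) linearP.
pose A := lin1_mx L.
have AE z : z *m A = L z by exact: mul_rV_linear.
have Afree : row_free A.
  rewrite -kermx_eq0; apply/eqP/row_matrixP => i; rewrite row0.
  apply: bracket_nondegenerate => w.
  have : L (row i (kermx A)) = 0 by rewrite -AE -row_mul mulmx_ker row0.
  move=> /(canRL (mxvecK)); rewrite linear0 => ad0.
  by rewrite -(mul_ad br_linr) ad0 mulmx0.
have [K K0 HK] := @linear_bounded R (n * n) 'rV[R]_n (fun v => v *m pinvmx A)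
  (fun r u v => etrans (mulmxDl _ _ _) (congr1 (+%R^~ _) (esym (scalemxAl _ _ _)))).
exists K => // z t t0 zt.
have -> : z = L z *m pinvmx A by rewrite -AE mulmxKp.
rewrite (le_trans (HK _)) // ler_wpM2l ?(ltW K0) //.
apply: norm_le_entries => // i j; rewrite ord1 {i}.
case/mxvec_indexP: j => i j; rewrite mxvecE.
have -> : ad_mx br z i j = (br z (delta_mx 0 i)) 0 j by rewrite mxE.
rewrite (le_trans (entry_le_norm _ _ _)) // (le_trans (zt _)) //.
rewrite ler_piMr //; apply: norm_le_entries => // i' j'.
by rewrite mxE; case: (_ && _); rewrite ?normr1 ?normr0.
Qed.

Variables (A : V -> V -> V) (e : V).
Hypothesis A_approx : forall eps, 0 < eps -> \forall y \near e, forall w,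
  `|A y w - w - br (y - e) w| <= eps * `|y - e| * `|w|.

(** If A y w = w + [y - e, w] up to a small error, as for A y = Ad y near the
    unit, then the deviation of A y from the identity is bounded above by a
    multiple of |y - e|, and below too when the bracket is nondegenerate. *)
Lemma approx_upper_bound : exists2 C, 0 < C & \forall y \near e,
  forall w, `|A y w - w| <= C * `|y - e| * `|w|.
Proof.
have [M M0 HM] := bracket_bounded.
exists (M + 1); first exact: addr_gt0.
apply: filterS (A_approx ltr01) => y H w.
rewrite -[_ - w](subrK (br (y - e) w)) (le_trans (ler_normD _ _)) //.
by rewrite addrC !mulrDl mul1r lerD // -[leRHS]mul1r mulrA.
Qed.

Lemma approx_lower_bound : exists2 K, 0 < K & \forall y \near e,
  forall t, 0 <= t -> (forall w, `|A y w - w| <= t * `|w|) ->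
  `|y - e| <= K * t.
Proof.
have [K K0 HK] := bracket_lower_bound.
have e0 : 0 < (2 * K)^-1 by rewrite invr_gt0 mulr_gt0.
exists (2 * K); first exact: mulr_gt0.
apply: filterS (A_approx e0) => y H t t0 Ht.
have := HK (y - e) (t + (2 * K)^-1 * `|y - e|) _ _.
have -> : K * (t + (2 * K)^-1 * `|y - e|) = K * t + `|y - e| / 2 by field; rewrite gt_eqF.
move=> HH; suff : `|y - e| <= K * t + `|y - e| / 2 by lra.
apply: HH => [|w]; first by rewrite addr_ge0 // mulr_ge0 // ltW.
rewrite mulrDl; have := H w; rewrite distrC => Hw.
rewrite -[br _ w](subrK (A y w - w)) addrC (le_trans (ler_normD _ _)) //.
by rewrite lerD.
Qed.

End Estimates.

Section AdApprox.
Variables (R : realType) (n : nat) (G : lieGroupType R n).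
Variable c : chart R n G.
Hypothesis c_atlas : atlas c.
Hypothesis c_unit : cdom c 1%g.

Local Notation e := (cmap c 1%g).
Local Notation V := 'rV[R]_n.
Local Notation br := (lie_bracket c).

Let br_linr := lie_bracket_linr c_atlas c_unit.

(** The error term is linear in w, so it suffices to bound it on the finitely many
    basis vectors. *)
Lemma Ad_approx eps : 0 < eps -> \forall y \near e, forall w,
  `|Ad c (cinv c y) w - w - br (y - e) w| <= eps * `|y - e| * `|w|.
Proof.
move=> eps0; pose eps' := eps / n.+1%:R.
have eps'0 : 0 < eps' by rewrite divr_gt0.
pose P (i : 'I_n) y := `|Ad c (cinv c y) (delta_mx 0 i) - delta_mx 0 i
    - br (y - e) (delta_mx 0 i)| <= eps' * `|y - e|.
have H : \forall y \near e, forall i : 'I_n, P i y.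
  apply: (@filter_forall _ _ P (nbhs e) _) => i.
  have := differentiable_approx (differentiable_Ad c_atlas c_unit (delta_mx 0 i)) eps'0.
  by apply: filterS => y; rewrite cinv_e // Ad1.
apply: filterS H => y H w.
pose D w := Ad c (cinv c y) w - w - br (y - e) w.
have Dlin : linear D.
  apply: linear_sub (br_linr _); apply: linear_sub => //.
  exact: Ad_linear.
rewrite (le_trans (linear_norm_le w Dlin H)) // ler_wpM2r // mulrA ler_wpM2r //.
rewrite /eps' mulrCA ler_piMr ?(ltW eps0) // ler_pdivrMr // mul1r ler_nat.
exact: leqnSn.
Qed.

End AdApprox.

(** * Noncompact isotropy *)

(** The factor tau is read off from a coordinate in which u does not vanish. *)
Lemma closed_halfline (R : realType) n (w u : 'rV[R]_n) b : u != 0 ->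
  (forall eps, 0 < eps -> exists2 rho, b <= rho & `|w - rho *: u| <= eps) ->
  exists2 tau, b <= tau & w = tau *: u.
Proof.
move=> u0 H; have [i ui] : exists i, u 0 i != 0.
  apply/existsP; apply: contraNT u0 => /existsPn ui; apply/eqP/rowP => i.
  by rewrite mxE; apply/eqP; have := ui i; rewrite negbK.
have ui0 : 0 < `|u 0 i| by rewrite normr_gt0.
have un0 : 0 < `|u| by rewrite normr_gt0.
pose tau := w 0 i / u 0 i.
have H' eps : 0 < eps ->
    exists rho, [/\ b <= rho, `|tau - rho| <= eps & `|w - rho *: u| <= eps].
  move=> eps0; have [|rho brho Hrho] := H (Num.min eps (eps * `|u 0 i|)).
    by rewrite lt_min eps0 mulr_gt0.
  exists rho; split => //; last by rewrite (le_trans Hrho) // ge_min lexx.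
  rewrite -(ler_pM2r ui0) -normrM mulrBl divfK //.
  have := entry_le_norm (w - rho *: u) 0 i; rewrite !mxE => /le_trans; apply.
  by rewrite (le_trans Hrho) // ge_min lexx orbT.
exists tau.
  apply/ler_addgt0Pr => eps /H'[rho [brho trho _]].
  rewrite (le_trans brho) // -lerBlDl (le_trans _ trho) // distrC ler_norm //.
apply/eqP; rewrite -subr_eq0 -normr_le0; apply/ler_addgt0Pr => eps eps0.
rewrite add0r; have [|rho [_ trho Hrho]] := H' (eps / (1 + `|u|)).
  by rewrite divr_gt0 // addr_gt0.
have -> : w - tau *: u = (w - rho *: u) + (rho - tau) *: u.
  by rewrite scalerBl addrA subrK.
rewrite (le_trans (ler_normD _ _)) // normrZ (distrC rho).
rewrite (@le_trans _ _ (eps / (1 + `|u|) + eps / (1 + `|u|) * `|u|)) //.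
  by rewrite lerD // ler_wpM2r.
by rewrite -{1}[eps / _]mulr1 -mulrDr divfK // gt_eqF // addr_gt0.
Qed.

Section NoncompactIsotropy.
Variables (R : realType) (n : nat) (G : lieGroupType R n).
Variable c : chart R n G.
Hypothesis c_atlas : atlas c.
Hypothesis c_unit : cdom c 1%g.

Local Notation e := (cmap c 1%g).
Local Notation V := 'rV[R]_n.
Local Notation br := (lie_bracket c).

(** Multiplicativity reduces continuity at a to continuity at the unit. *)
Lemma Ad_cvg (T : Type) (F : set_system T) {FF : Filter F} (f : T -> G) a w :
  f @ F --> a -> (fun x => Ad c (f x) w) @ F --> Ad c a w.
Proof.
move=> fa.
have f1 : (fun x => a^-1 * f x)%g @ F --> (1%g : G).
  by have := @mulg_cvg _ _ G _ F _ _ _ _ _ (@cvg_cst G a^-1%g _ F _) fa; rewrite mulVg; apply.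
have fd : \forall x \near F, cdom c (a^-1 * f x)%g by exact: (f1 _ (near_cdom c_unit)).
have fe : (fun x => cmap c (a^-1 * f x)%g) @ F --> e.
  exact: (cvg_comp _ _ f1 (cmap_cvg c_unit)).
have g1 : (fun x => Ad c (cinv c (cmap c (a^-1 * f x)%g)) w) @ F --> w.
  have : (fun x => Ad c (cinv c x) w) @ e --> Ad c (cinv c e) w.
    exact: (differentiable_continuous (differentiable_Ad c_atlas c_unit w)).
  rewrite (cinv_e c_unit) (Ad1 c_unit) => h.
  exact: (cvg_comp _ _ fe h).
have [t t0 Ht] := linear_bounded (Ad_linear c_atlas c_unit a).
apply/cvgrPdist_le => eps eps0.
have /cvgrPdist_le/(_ (eps / t)) := g1.
rewrite divr_gt0 // => /(_ isT) g2.
apply: filterS2 fd g2 => x xd; rewrite cmapKd // => xw.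
have -> : Ad c (f x) w = Ad c a (Ad c (a^-1 * f x)%g w).
  by rewrite -(AdM c_atlas c_unit) mulgA mulgV mul1g.
have -> : Ad c a w - Ad c a (Ad c (a^-1 * f x)%g w) = Ad c a (w - Ad c (a^-1 * f x)%g w).
  move: (Ad c (a^-1 * f x)%g w) (Ad c a) (Ad_linear c_atlas c_unit a) => w' h hlin.
  by rewrite [w - w']addrC -[- w' in RHS]scaleN1r hlin scaleN1r addrC.
by rewrite (le_trans (Ht _)) // -ler_pdivlMl // mulrC.
Qed.

Lemma Ad_expg g j w : Ad c (g ^+ j)%g w = iter j (Ad c g) w.
Proof.
elim: j => [|j IH]; first by rewrite expg0 (Ad1 c_unit).
by rewrite expgS (AdM c_atlas c_unit) IH.
Qed.

Hypothesis g_semisimple : semisimple br.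

Let br_linl := lie_bracket_linl c_atlas c_unit.
Let br_linr := lie_bracket_linr c_atlas c_unit.

Lemma near_normP (x : V) (P : set V) :
  (\forall y \near x, P y) -> exists2 r, 0 < r & forall y, `|y - x| < r -> P y.
Proof.
move=> /nbhs_ballP[r r0 rP]; exists r => // y yr; apply: rP.
by rewrite -ball_normE /ball_ /= distrC.
Qed.

Lemma near_chart_mul (r : R) : 0 < r -> exists2 r1, 0 < r1 & forall y z,
  `|y - e| < r1 -> `|z - e| < r1 -> chart_mul_dom c (y, z) /\ `|chart_mul c (y, z) - e| < r.
Proof.
move=> r0.
have W := chart_mul_dom_e c_unit (cim_e c_unit).
have mcont := differentiable_continuous (smooth_on_differentiable (chart_mul_smooth c_atlas) W).
have me : chart_mul c (e, e) = e by rewrite /chart_mul /= (cinv_e c_unit) mulg1.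
have N1 : \forall z \near (e, e), chart_mul_dom c z.
  by apply: open_nbhs_nbhs; split => //; case: (chart_mul_smooth c_atlas).
have N2 : \forall z \near (e, e), `|chart_mul c z - e| < r.
  have : chart_mul c @ (e, e) --> e by rewrite -{3}me; exact: mcont.
  by move=> /cvgrPdist_lt/(_ r r0); apply: filterS => z; rewrite distrC.
have [[A B] [/= nA nB] AB] := filterI N1 N2.
have [a a0 aA] := near_normP nA; have [b b0 bB] := near_normP nB.
exists (Num.min a b) => [|y z ya zb]; first by rewrite lt_min a0.
rewrite lt_min in ya; rewrite lt_min in zb; case/andP: ya zb => ya _ /andP[_ zb].
by have [] : (chart_mul_dom c `&` [set z | `|chart_mul c z - e| < r]) (y, z)
  by apply: AB; split; [exact: aA | exact: bB].
Qed.

(** The element a is a substitute for exp (2 t x), obtained without the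
    exponential map as a limit point of powers, of index about 2 t m, of the
    elements of coordinates e + x / m.  On an eigenvector these powers act
    approximately by rho = (1 + s / m)^j, which is exactly 1 when s = 0.  The
    lower bound for Ad - 1 near the unit keeps the powers in a compact
    neighbourhood of the unit. *)
Lemma exists_exp_like (x : V) (sigma : R) : 0 <= sigma ->
  exists (t : R) (a : G), 0 < t /\ forall (w : V) (s : R),
    0 <= s <= sigma -> br x w = s *: w -> forall eps, 0 < eps ->
    exists2 rho, 1 + s * t <= rho /\ (s = 0 -> rho = 1) & `|Ad c a w - rho *: w| <= eps.
Proof.
move=> sigma0.
have approx := Ad_approx c_atlas c_unit.
have [C C0 nU] := approx_upper_bound br_linl br_linr approx.
have [K K0 nL] := approx_lower_bound br_linl br_linr g_semisimple approx.
have [r r0 rP] := near_normP (filterI (near_cim (cim_e c_unit)) (filterI nU nL)).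
have [r1 r10 mulP] := near_chart_mul r0.
pose r' := Num.min r r1 / 2.
have min0 : 0 < Num.min r r1 by rewrite lt_min r0.
have r'0 : 0 < r' by rewrite divr_gt0.
have r'min : r' < Num.min r r1 by rewrite ltr_pdivrMr // ltr_pMr // ltr1n.
have [r'r r'r1] : r' < r /\ r' < r1 by move: r'min; rewrite lt_min => /andP[].
pose q := 2 * C * (`|x| + 1).
have q0 : 0 < q by rewrite !mulr_gt0 // ltr_wpDl.
pose X := q * K / r'.
have X0 : 0 < X by rewrite divr_gt0 // mulr_gt0.
pose S := q + X + 2 * sigma + 1.
have S0 : 0 < S by rewrite /S; lra.
(* t is small enough for all smallness conditions met below *)
pose t := S^-1.
have t0 : 0 < t by rewrite invr_gt0.
have tS : t * S = 1 by rewrite mulVf // gt_eqF.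
have qt : q * t <= 1 by rewrite -[leRHS]tS mulrC ler_wpM2l ?(ltW t0) // /S; lra.
have sigt : 2 * sigma * t <= 1 by rewrite -[leRHS]tS mulrC ler_wpM2l ?(ltW t0) // /S; lra.
have qKt : K * (q * t) <= r'.
  have h : X * t <= 1 by rewrite -[leRHS]tS mulrC ler_wpM2l ?(ltW t0) // /S; lra.
  have -> : K * (q * t) = (X * t) * r' by rewrite /X; field; rewrite gt_eqF.
  by rewrite ler_piMl // ltW.
pose y (m : nat) := e + m%:R^-1 *: x.
pose g m := cinv c (y m).
have yE m : y m - e = m%:R^-1 *: x by rewrite /y addrC addKr.
have yn m : `|y m - e| = m%:R^-1 * `|x|.
  by rewrite yE normrZ ger0_norm // invr_ge0.
pose j m := Num.truncn (t * m%:R).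
have jle m : (j m)%:R <= t * m%:R by rewrite truncn_le mulr_ge0 // ltW.
have jd m i : (0 < m)%N -> i%:R <= t * m%:R -> i%:R * `|y m - e| <= t * `|x|.
  move=> m0 im; rewrite yn mulrA ler_wpM2r //.
  by rewrite ler_pdivrMr // ltr0n.
have ad m i : (0 < m)%N -> i%:R <= t * m%:R -> 2 * (C * `|y m - e|) * i%:R <= q * t.
  move=> m0 im; have := jd m i m0 im; rewrite /q.
  have := C0; have := t0; have : 0 <= `|x| by [].
  set d := `|y m - e|; set nx := `|x|; move: (i%:R : R) => I nx0 t0' C0' Id.
  have : 2 * C * (I * d) <= 2 * C * (t * nx) by rewrite ler_wpM2l // mulr_ge0 // ltW.
  have : 0 <= 2 * C * t by rewrite !mulr_ge0 // ltW.
  lra.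
have near_y : \forall m \near \oo, (0 < m)%N /\ `|y m - e| < Num.min r r1.
  have inf : \forall m \near \oo, (Num.truncn (`|x| / Num.min r r1) < m)%N.
    exact: nbhs_infty_gt.
  apply: filterS inf => m hm; have m0 : (0 < m)%N by apply: leq_ltn_trans hm.
  split => //; rewrite yn mulrC ltr_pdivrMr ?ltr0n // mulrC -ltr_pdivrMr //.
  by rewrite (lt_le_trans (real_truncnS_gt _)) ?num_real // ler_nat.
(* The upper bound controls Ad of the power in terms of its exponent, and the
   lower bound then confines the power itself to the ball of radius r', from
   which one more factor cannot leave the ball of radius r. *)
have stay m i : (0 < m)%N -> `|y m - e| < Num.min r r1 -> i%:R <= t * m%:R ->
    cdom c (g m ^+ i)%g /\ `|cmap c (g m ^+ i)%g - e| <= r'.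
  move=> m0; rewrite lt_min => /andP[yr yr1].
  have [_ [Uy _]] := rP _ yr.
  elim: i => [|i IH] im; first by rewrite expg0 subrr normr0 (ltW r'0).
  have im' : i%:R <= t * m%:R by rewrite (le_trans _ im) // ler_nat.
  have [di zi] := IH im'.
  have [[_ _ dS] nS] := mulP _ _ (le_lt_trans zi r'r1) yr1.
  move: dS nS; rewrite /chart_mul /= (cmapKd di) -/(g m) -expgSr => dS nS.
  split => //; have [_ [_ Ly]] := rP _ nS.
  have adi := ad m i.+1 m0 im.
  rewrite (le_trans (Ly (2 * (C * `|y m - e|) * i.+1%:R) _ _)) //.
  - by rewrite !mulr_ge0 // ltW.
  - move=> w; rewrite (cmapKd dS) Ad_expg.
    apply: iter_near_id; [exact: Uy | by rewrite mulr_ge0 // ltW | exact: le_trans qt].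
  - by rewrite (le_trans _ qKt) // ler_wpM2l // ltW.
pose h m := (g m ^+ j m)%g.
pose z m := cmap c (h m).
pose B := closed_ball_ Num.norm e r'.
have Bcompact : compact B.
  apply: bounded_closed_compact; last exact: closed_closed_ball_.
  exists (`|e| + r'); split; first exact: num_real.
  move=> M HM v; rewrite /B /closed_ball_ /= => Hv.
  rewrite (le_trans _ (ltW HM)) // -[v](subrK e) addrC (le_trans (ler_normD _ _)) //.
  by rewrite lerD2l distrC.
have FB : (z @ \oo) B.
  apply: filterS near_y => m [m0 ym]; rewrite /B /closed_ball_ /= distrC.
  by have [] := stay m (j m) m0 ym (jle m).
have [zs [Bzs zcl]] := Bcompact (z @ \oo) _ FB.
have zr : `|zs - e| < r by rewrite distrC (le_lt_trans Bzs).
have [zc _] := rP _ zr.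
(* t / 2 rather than t, since j m is t * m rounded down *)
exists (t / 2), (cinv c zs); split; first by rewrite divr_gt0.
move=> w s /andP[s0 ss] xw eps eps0.
pose eps' := eps / 2 / (4 * t * (`|x| * `|w|) + 1).
have D0 : 0 < 4 * t * (`|x| * `|w|) + 1 by rewrite ltr_wpDl // !mulr_ge0 // ltW.
have eps'0 : 0 < eps' by rewrite !divr_gt0.
have [r2 r20 HA] := near_normP (approx _ eps'0).
have near_y2 : \forall m \near \oo, `|y m - e| < r2 /\ 2 / t < m%:R.
  have inf : \forall m \near \oo, (Num.truncn (`|x| / r2) < m)%N /\
      (Num.truncn (2 / t) < m)%N.
    by apply: filterI; exact: nbhs_infty_gt.
  apply: filterS inf => m [hm hm']; have m0 : (0 < m)%N by apply: leq_ltn_trans hm.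
  split; last by rewrite (lt_le_trans (real_truncnS_gt _)) ?num_real // ler_nat.
  rewrite yn mulrC ltr_pdivrMr ?ltr0n // mulrC -ltr_pdivrMr //.
  by rewrite (lt_le_trans (real_truncnS_gt _)) ?num_real // ler_nat.
have Acv : (fun u => Ad c (cinv c u) w) @ zs --> Ad c (cinv c zs) w.
  exact: (@Ad_cvg _ (nbhs zs) _ (cinv c) _ w (cinv_cvg zc)).
have e20 : 0 < eps / 2 by rewrite divr_gt0.
have nA : \forall u \near zs, `|Ad c (cinv c zs) w - Ad c (cinv c u) w| <= eps / 2.
  by move/cvgrPdist_le: Acv => /(_ _ e20).
have : (z @ \oo) (z @` [set m | [/\ (0 < m)%N, `|y m - e| < Num.min r r1,
    `|y m - e| < r2 & 2 / t < m%:R]]).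
  apply: filterS (filterI near_y near_y2) => m [[? ?] [? ?]].
  by exists m.
move=> /zcl/(_ nA)[_ [[m [m0 ym ym2 mt] <-]]] /=.
have [dm _] := stay m (j m) m0 ym (jle m).
rewrite /z (cmapKd dm) /h Ad_expg => Hclose.
have yr : `|y m - e| < r by move: ym; rewrite lt_min => /andP[].
have [_ [Uy _]] := rP _ yr.
have mR : 0 < m%:R :> R by rewrite ltr0n.
pose rho := (1 + s / m%:R) ^+ j m.
have sm0 : 0 <= s / m%:R by rewrite divr_ge0.
exists rho.
  split; last by move=> s00; rewrite /rho s00 mul0r addr0 expr1n.
  rewrite (le_trans _ (bernoulli_le _ sm0)) // lerD2l mulrAC -!mulrA ler_wpM2l //.
  rewrite ler_pdivlMr //.
  have : t * m%:R < (j m).+1%:R by apply: real_truncnS_gt; exact: num_real.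
  have : 2 < t * m%:R by rewrite mulrC -ltr_pdivrMr.
  rewrite -[(j m).+1%:R]natr1 mulrAC; move: (t * m%:R) ((j m)%:R : R) => tm J; lra.
have eta : `|Ad c (g m) w - (1 + s / m%:R) *: w| <= eps' * `|y m - e| * `|w|.
  have E : br (y m - e) w = (s / m%:R) *: w.
    by rewrite yE (brZl br_linl) xw scalerA mulrC.
  have := HA _ ym2 w; rewrite -/(g m) E.
  by move: (Ad c (g m) w) => w'; rewrite scalerDl scale1r opprD addrA.
have sj : 2 * (s / m%:R) * (j m)%:R <= 1.
  rewrite (le_trans _ sigt) // -!mulrA ler_wpM2l // [_^-1 * _]mulrC.
  rewrite (@le_trans _ _ (s * t)) //; last by rewrite ler_wpM2r // ltW.
  by rewrite ler_wpM2l // ler_pdivrMr.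
have aj : 2 * (C * `|y m - e|) * (j m)%:R <= 1.
  by rewrite (le_trans (ad m (j m) m0 (jle m))).
have a0 : 0 <= C * `|y m - e| by rewrite mulr_ge0 // ltW.
have := iter_near_eigen Uy (Ad_linear c_atlas c_unit (g m)) a0 sm0 aj sj eta.
rewrite -/rho => Hnear.
have -> : Ad c (cinv c zs) w - rho *: w =
    (Ad c (cinv c zs) w - iter (j m) (Ad c (g m)) w)
    + (iter (j m) (Ad c (g m)) w - rho *: w) by rewrite addrA subrK.
rewrite (le_trans (ler_normD _ _)) // [leRHS]splitr lerD // (le_trans Hnear) //.
have jdm := jd m (j m) m0 (jle m).
have -> : 4 * (j m)%:R * (eps' * `|y m - e| * `|w|) =
  4 * ((j m)%:R * `|y m - e|) * `|w| * eps' by ring.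
rewrite /eps'; set A := 4 * _ * _; set E := eps / 2.
rewrite (mulrA A) ler_pdivrMr // [leRHS]mulrC ler_wpM2r ?(ltW e20) // /A.
rewrite (@le_trans _ _ (4 * (t * `|x|) * `|w|)) //.
  by rewrite ler_wpM2r // ler_wpM2l.
by rewrite -!mulrA lerDl.
Qed.

(** The powers of the element given by [exists_exp_like] fix v and multiply u by
    the powers of a number larger than 1, whereas Ad is bounded on compact sets. *)
Lemma isotropy_noncompact (v x u : V) (s : R) : br x v = 0 -> br x u = s *: u ->
  0 < s -> u != 0 -> ~ compact (isotropy c v).
Proof.
move=> xv xu s0 u0 cK.
have [t [a [t0 Ha]]] := exists_exp_like x (ltW s0).
have av : Ad c a v = v.
  apply/eqP; rewrite -subr_eq0 -normr_le0; apply/ler_addgt0Pr => eps eps0.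
  have [||rho [_ ->] //] := Ha v 0 _ _ eps eps0; first by rewrite lexx (ltW s0).
    by rewrite scale0r.
  by rewrite scale1r add0r.
have [tau tau1 au] : exists2 tau, 1 + s * t <= tau & Ad c a u = tau *: u.
  apply: closed_halfline => // eps eps0.
  have [|rho [H _] ?] := Ha u s _ xu eps eps0; first by rewrite lexx (ltW s0).
  by exists rho.
have aN N : isotropy c v (a ^+ N)%g.
  rewrite /isotropy /= Ad_expg; elim: N => //= N ->.
  exact: av.
have auN N : Ad c (a ^+ N)%g u = tau ^+ N *: u.
  rewrite Ad_expg; elim: N => [|N IH]; first by rewrite expr0 scale1r.
  rewrite iterS IH exprS.
  have hlin := Ad_linear c_atlas c_unit a.
  have hZ b : Ad c a (b *: u) = b *: Ad c a u.
    have h0 : Ad c a 0 = 0.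
      by have := hlin (-1) 0 0; rewrite scaler0 addr0 scaleN1r addNr.
    by have := hlin b u 0; rewrite h0 !addr0.
  by rewrite hZ au scalerA mulrC.
have acont : continuous (fun g => Ad c g u).
  move=> g; exact: (@Ad_cvg _ (nbhs g) _ id g u cvg_id).
have := continuous_compact (continuous_subspaceT acont) cK.
move=> /compact_bounded[M0 [_ HM]].
pose M := `|M0| + 1.
have M0M : M0 < M by rewrite (le_lt_trans (ler_norm _)) // ltrDl.
have bound N : tau ^+ N * `|u| <= M.
  have tau0 : 0 <= tau by rewrite (le_trans _ tau1) // addr_ge0 // mulr_ge0 // ltW.
  rewrite -[tau ^+ N]ger0_norm ?exprn_ge0 // -normrZ -auN.
  by apply: (HM M M0M); exists (a ^+ N)%g.
have un : 0 < `|u| by rewrite normr_gt0.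
have st : 0 < s * t by rewrite mulr_gt0.
pose N := Num.truncn (M / `|u| / (s * t)).
have : M / `|u| < tau ^+ N.+1.
  rewrite (@lt_le_trans _ _ ((1 + s * t) ^+ N.+1)) //; last first.
    by rewrite lerXn2r ?nnegrE // ?addr_ge0 // ?(ltW st) // (le_trans _ tau1) // addr_ge0 // ltW.
  rewrite (lt_le_trans _ (bernoulli_le _ (ltW st))) // ltr_wpDl //.
  by rewrite [ltRHS]mulrC -ltr_pdivrMr //; exact: real_truncnS_gt (num_real _).
by rewrite ltr_pdivrMr // ltNge bound.
Qed.

End NoncompactIsotropy.

(** * Comparison of phi' and psi' *)

(** With a, b, c for (x, x), (y, y) and (x, y). *)
Lemma same_sign (R : realFieldType) (a b c l m : R) :
  0 < a -> 0 < b -> 0 < c -> l * c <= m * b -> m * c <= l * a ->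
  (l < 0 /\ m < 0) \/ (l = 0 /\ m = 0) \/ (0 < l /\ 0 < m).
Proof.
move=> a0 b0 c0 lc mc.
have [l0|l0|l0] := ltgtP l 0; have [m0|m0|m0] := ltgtP m 0;
  first [by left | by right; left | by right; right | exfalso; nra].
Qed.

(** Abstract setting of the final argument: V carries a scalar product given by a
    finite system of weights d, D is the set of positive roots, and pd x stands
    for x'.  Keeping these objects abstract separates the inequalities from the
    Lie algebra. *)
Section Comparison.
Variables (R : realFieldType) (V : lmodType R) (ip : V -> V -> R).
Hypothesis ip_linr : forall x, scalar (ip x).
Hypothesis ipC : forall x y, ip x y = ip y x.
Hypothesis ip_gt0 : forall x, x != 0 -> 0 < ip x x.
Variables (D : seq V) (eps : V -> R) (pd : V -> V).
Variables (n : nat) (d : 'I_n -> V).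
Hypothesis d_weights : forall j, [\/ d j = 0, d j \in D | - d j \in D].
Hypothesis D_weights : forall a, a \in D -> exists j, a = d j.
Hypothesis ip_weights : forall x y, ip x y = \sum_j ip x (d j) * ip y (d j).
Hypothesis pdE : forall x y, ip y (pd x) =
  - 2 * \sum_(a <- D) (if ip x a == 0 then 0 else eps a * ip y a).
Implicit Types x y a : V.

Lemma ip0r x : ip x 0 = 0.
Proof. by have := ip_linr x (-1) 0 0; rewrite scaler0 addr0 mulN1r addNr. Qed.

Lemma ipZr c x y : ip x (c *: y) = c * ip x y.
Proof. by have := ip_linr x c y 0; rewrite ip0r !addr0. Qed.

Lemma ipDr x y z : ip x (y + z) = ip x y + ip x z.
Proof. by have := ip_linr x 1 y z; rewrite scale1r mul1r. Qed.

Lemma ipNr x y : ip x (- y) = - ip x y.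
Proof. by rewrite -scaleN1r ipZr mulN1r. Qed.

Definition dominant x := forall a, a \in D -> 0 <= ip x a.

Lemma dominant_weight_ge0 x y j : dominant x -> dominant y ->
  0 <= ip x (d j) * ip y (d j).
Proof.
move=> dx dy; have [->|Dj|Dj] := d_weights j; first by rewrite ip0r mul0r.
  by rewrite mulr_ge0 ?dx ?dy.
by rewrite -[d j]opprK ipNr [ip y _]ipNr mulrNN mulr_ge0 ?dx ?dy.
Qed.

Lemma dominant_ip_ge0 x y : dominant x -> dominant y -> 0 <= ip x y.
Proof. by move=> dx dy; rewrite ip_weights sumr_ge0 // => j _; exact: dominant_weight_ge0. Qed.

Lemma dominant_ip_gt0 x y a : dominant x -> dominant y ->
  a \in D -> ip x a != 0 -> ip y a != 0 -> 0 < ip x y.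
Proof.
move=> dx dy aD xa ya; have [j aE] := D_weights aD.
rewrite ip_weights (bigD1 j) //= ltr_pwDl //.
  by rewrite lt_def dominant_weight_ge0 // -aE mulf_neq0.
by rewrite sumr_ge0 // => i _; exact: dominant_weight_ge0.
Qed.

Lemma exists_nonorth x : x != 0 -> exists2 a, a \in D & ip x a != 0.
Proof.
move=> x0; apply: contrapT => no.
have x_orth a : a \in D -> ip x a = 0.
  by move=> aD; apply/eqP; apply: contraT => xa; case: no; exists a.
have := ip_gt0 x0; rewrite ip_weights big1 ?ltxx // => j _.
have [->|Dj|Dj] := d_weights j; first by rewrite ip0r mul0r.
  by rewrite x_orth // mul0r.
by rewrite -[d j]opprK ipNr x_orth // oppr0 mul0r.
Qed.

(** In the application, eps a = -1 means that the root a is compact. *)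
Definition compact_on_orth x := forall a, a \in D -> ip x a = 0 -> eps a = -1.

(** The two sums differ in the terms with (x, a) = 0 only, up to terms with
    (y, a) = 0, and there eps a = -1. *)
Lemma pd_comparison x y : compact_on_orth x -> dominant y ->
  ip y (pd x) <= ip y (pd y).
Proof.
move=> tx dy; rewrite !pdE ler_nM2l ?oppr_lt0 //.
rewrite big_seq [leRHS]big_seq ler_sum // => a aD.
have [->|ya] := eqVneq (ip y a) 0; first by rewrite mulr0 if_same.
have [xa|//] := eqVneq (ip x a) 0.
by rewrite tx // mulN1r oppr_le0 dy.
Qed.

Lemma pd_eigenvalue_gt0 x l : x != 0 -> dominant x ->
  (forall a, a \in D -> eps a = -1) -> pd x = l *: x -> 0 < l.
Proof.
move=> x0 dx eN xE; rewrite -(pmulr_lgt0 _ (ip_gt0 x0)) -ipZr -xE pdE.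
have [a aD xa] := exists_nonorth x0.
rewrite nmulr_rgt0 ?oppr_lt0 // -oppr_gt0 -sumrN (big_rem a) //= (negPf xa).
rewrite eN // mulN1r opprK ltr_pwDl //; first by rewrite lt_def xa dx.
rewrite big_seq sumr_ge0 // => b /mem_rem bD.
by case: eqP => _; rewrite ?oppr0 // eN // mulN1r opprK dx.
Qed.

(** If eps is -1 on all of D then both eigenvalues are positive; otherwise
    (x, y) > 0 and the signs are read off from the two comparisons. *)
Lemma pd_eigenvectors x y l m :
  x != 0 -> y != 0 -> dominant x -> dominant y ->
  compact_on_orth x -> compact_on_orth y -> pd x = l *: x -> pd y = m *: y ->
  ((l < 0 /\ m < 0) \/ (l = 0 /\ m = 0) \/ (0 < l /\ 0 < m))
  /\ (l < 0 -> m < 0 -> exists2 c, c != 0 & y = c *: x).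
Proof.
move=> x0 y0 dx dy tx ty xE yE.
have xx := ip_gt0 x0; have yy := ip_gt0 y0; have xy := dominant_ip_ge0 dx dy.
have I1 : l * ip x y <= m * ip y y.
  by have := pd_comparison tx dy; rewrite xE yE !ipZr (ipC y x).
have I2 : m * ip x y <= l * ip x x.
  by have := pd_comparison ty dx; rewrite xE yE !ipZr.
split; last first.
  move=> l0 m0.
  have xy0 : 0 < ip x y.
    rewrite lt_def xy andbT; apply/eqP => e; move: I1.
    by rewrite e mulr0 pmulr_lge0 // leNgt m0.
  pose c := ip x y / ip x x.
  have c0 : c != 0 by rewrite mulf_neq0 ?invr_eq0 ?gt_eqF.
  exists c => //; apply/eqP; rewrite -subr_eq0; apply: contraT => /ip_gt0.
  have cxx : c * ip x x = ip x y by rewrite divfK ?gt_eqF.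
  set v := y - c *: x; have vx : ip v x = 0 by rewrite ipC ipDr ipNr ipZr cxx subrr.
  have -> : ip v v = ip y y - c * ip x y.
    rewrite {2}/v ipDr ipNr ipZr vx mulr0 subr0 ipC /v ipDr ipNr ipZr.
    by rewrite (ipC y x).
  move=> h.
  have : ip x x * (ip y y - c * ip x y) > 0 by rewrite mulr_gt0.
  rewrite mulrBr mulrA [_ * c]mulrC cxx subr_gt0 ltNge; apply: contraNT => _.
  nra.
have [[a [aD ea]]|alle] :
    (exists a, a \in D /\ eps a != -1) \/ (forall a, a \in D -> eps a = -1).
- have [?|no] := pselect (exists a, a \in D /\ eps a != -1); first by left.
  right=> a aD; apply/eqP; apply: contraT => ea; case: no; by exists a.
- have nz z : compact_on_orth z -> ip z a != 0.
    by move=> tz; apply: contraNneq ea => za; rewrite (tz a).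
  have xy0 := dominant_ip_gt0 dx dy aD (nz _ tx) (nz _ ty).
  exact: same_sign xx yy xy0 I1 I2.
- by right; right; split; [exact: pd_eigenvalue_gt0 xE | exact: pd_eigenvalue_gt0 yE].
Qed.

End Comparison.

(** * Roots orthogonal to phi and the functional phi' *)

Section RootSums.
Variables (R : realType) (n : nat) (br : 'rV[R]_n -> 'rV[R]_n -> 'rV[R]_n).
Hypothesis br_linl : forall y, linear (br^~ y).
Hypothesis br_linr : forall x, linear (br x).
Hypothesis br_leibniz : forall u x y,
  br u (br x y) = br (br u x) y + br x (br u y).
Variable theta : 'End('rV[R]_n).
Hypothesis theta_cartan : cartan_involution br theta.
Variables k p h0 : {vspace 'rV[R]_n}.
Hypothesis k_fixed : forall x, (x \in k) = (theta x == x).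
Hypothesis h0_k : (h0 <= k)%VS.
Hypothesis h0_abelian : abelian_subspace br h0.
Variable Dpos : set (hRdual h0).
Hypothesis Dpos_positive : positive_system br Dpos.
Implicit Types phi psi alpha : hRdual h0.

Local Open Scope complex_scope.
Local Notation eps := (epsilon br k p).

Let h0_fixed h : h \in h0 -> theta h = h.
Proof. by move=> /(subvP h0_k); rewrite k_fixed => /eqP. Qed.

(** If some root vector z is not in the complexification of k, then the real or
    the imaginary part x of z satisfies x - theta x != 0.  Since alpha vanishes at
    h_phi, this element of p commutes with h_phi. *)
Lemma noncompact_vector phi alpha :
  eps alpha != -1 -> ip br phi alpha = 0 ->
  exists x, [/\ theta x = - x, x != 0 & br (vsval (hvec br phi)) x = 0].
Proof.
rewrite /epsilon; case: asboolP => [|ncpt _ ip0]; first by rewrite eqxx.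
set h := hvec br phi; have hk : theta (vsval h) = vsval h by exact/h0_fixed/subvsP.
have [_ theta_br _] := theta_cartan.
have thetaK x : theta (theta x) = x by case: theta_cartan.
have [z zr zk] : exists2 z, root_space br alpha z & ~ csubspace k z.
  by apply: contrapT => nz; apply: ncpt => z zr; apply: contrapT => zk; apply: nz; exists z.
have proj x : br (vsval h) x = 0 -> x \notin k ->
    exists x, [/\ theta x = - x, x != 0 & br (vsval h) x = 0].
  move=> hx xk; exists (x - theta x); split.
  - by rewrite linearB /= thetaK opprB.
  - by rewrite subr_eq0 eq_sym -k_fixed.
  - rewrite brDr // hx add0r -scaleN1r brZr // -[in X in br X _]hk -theta_br hx.
    by rewrite linear0 scaler0.
have alpha_h : alpha h = 0 by rewrite -(ipE br_linl br_linr theta_cartan h0_fixed).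
have := zr h; rewrite alpha_h scale0r cbr_toC // => z0.
have [hr hi] : br (vsval h) (re_part z) = 0 /\ br (vsval h) (im_part z) = 0.
  have cplx0 : cplx (0 : 'rV[R]_n) = 0 by exact: map_mx0.
  apply: cplx_inj; rewrite !cplx0 scaler0 addr0.
  have : z *m map_mx (real_complex R) (ad_mx br (vsval h)) = 0.
    apply: (scalerI (_ : 'i%C != 0 :> R[i])); first by rewrite eq_complex /= oner_eq0 andbF.
    by rewrite scaler0 scalemxAr.
  rewrite {1}(cplx_re_im z) mulmxDl -scalemxAl /cplx -!map_mxM !mul_ad //.
have [rk|rk] := boolP (re_part z \in k); last exact: (proj _ hr).
have [ik|ik] := boolP (im_part z \in k); last exact: (proj _ hi).
by case: zk.
Qed.

Let ipC := ipC br_linl br_linr theta_cartan h0_fixed.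
Let ip_linr := ip_linr br_linl br_linr theta_cartan h0_fixed.
Let ip_gt0 := ip_gt0 br_linl br_linr theta_cartan h0_fixed.

Lemma Dpos_root alpha : Dpos alpha -> Defs.roots br alpha.
Proof. by case: Dpos_positive => /(_ alpha). Qed.

Lemma Dpos_finite : finite_set Dpos.
Proof.
have [d [_ dr _]] := weights br_linl br_linr br_leibniz theta_cartan h0_fixed h0_abelian.
apply: (@sub_finite_set _ _ (range d)); last exact: finite_image.
by move=> alpha /Dpos_root/dr[j ->]; exists j.
Qed.

Lemma ip_prime_dual phi psi : ip br psi (prime_dual br k p Dpos phi) =
  - 2 * \sum_(alpha <- finmap.enum_fset (fset_set Dpos))
    (if ip br phi alpha == 0 then 0 else eps alpha * ip br psi alpha).
Proof.
rewrite /prime_dual (ipZr ip_linr); congr (_ * _).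
rewrite setDE fsbig_mkcondr fsbig_finite; last exact: Dpos_finite.
rewrite (big_morph (ip br psi) (ipDr ip_linr psi) (ip0r ip_linr psi)); apply: eq_bigr => alpha _.
case: eqP => [a0|a0].
  by rewrite memNset ?(ip0r ip_linr) //=; apply.
by rewrite mem_set //= (ipZr ip_linr).
Qed.

(** Holds when the isotropy of i h_phi is compact: an element of p commuting with
    h_phi would generate an unbounded subgroup of it. *)
Definition noncompactly_regular phi := forall x,
  theta x = - x -> x != 0 -> br (vsval (hvec br phi)) x != 0.

Lemma hvec0 : vsval (hvec br (0 : hRdual h0)) = 0.
Proof.
apply/eqP; apply: contraT => v0.
have := killing_fixed_lt0 theta_cartan (h0_fixed (subvsP _)) v0.
have := hvecE br_linl br_linr theta_cartan h0_fixed 0 (hvec br 0).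
by rewrite zero_lfunE -oppr_gt0 => <-; rewrite ltxx.
Qed.

Lemma prime_dual_proportional phi psi lambda mu :
  phi != 0 -> psi != 0 ->
  dominant_chamber br Dpos phi -> dominant_chamber br Dpos psi ->
  noncompactly_regular phi -> noncompactly_regular psi ->
  prime_dual br k p Dpos phi = lambda *: phi ->
  prime_dual br k p Dpos psi = mu *: psi ->
  ((lambda < 0 /\ mu < 0) \/ (lambda = 0 /\ mu = 0) \/ (0 < lambda /\ 0 < mu))
  /\ (lambda < 0 -> mu < 0 -> exists2 c, c != 0 & psi = c *: phi).
Proof.
move=> phi0 psi0 dphi dpsi rphi rpsi phiE psiE.
have Dfin := Dpos_finite.
have DP alpha : alpha \in finmap.enum_fset (fset_set Dpos) <-> Dpos alpha.
  have -> : (alpha \in finmap.enum_fset (fset_set Dpos)) = (alpha \in Dpos).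
    exact: in_fset_set.
  by rewrite inE.
have [d [dr rd dE]] := weights br_linl br_linr br_leibniz theta_cartan h0_fixed h0_abelian.
have dom f : dominant_chamber br Dpos f ->
    dominant (ip br (h0:=h0)) (finmap.enum_fset (fset_set Dpos)) f.
  by move=> df alpha /DP; exact: df.
have trans f : noncompactly_regular f ->
    compact_on_orth (ip br (h0:=h0)) (finmap.enum_fset (fset_set Dpos))
      (epsilon br k p (h0:=h0)) f.
  move=> rf alpha _ fa; apply/eqP; apply: contraT => ea.
  have [x [xp x0 fx]] := noncompact_vector ea fa.
  by have := rf x xp x0; rewrite fx eqxx.
apply: (pd_eigenvectors
  ip_linr ipC ip_gt0 _ _ dE ip_prime_dual
  phi0 psi0 (dom _ dphi) (dom _ dpsi) (trans _ rphi) (trans _ rpsi) phiE psiE).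
- move=> j; have [->|rj] := dr j; first exact: Or31.
  case: Dpos_positive => _ /(_ _ rj)[Dj|Dj] _ _; first by apply: Or32; exact/DP.
  by apply: Or33; exact/DP.
- by move=> alpha /DP/Dpos_root; exact: rd.
Qed.

End RootSums.

(** * The theorem *)

Lemma isotropy0 (R : realType) (n : nat) (G : lieGroupType R n) (c : chart R n G) :
  isotropy c 0 = [set: G].
Proof. by rewrite eqEsubset; split => // g _; exact: derive0. Qed.

Theorem proposition4p2 (R : realType) (n : nat) (G : lieGroupType R n)
  (c : chart R n G) (c_atlas : atlas c) (c_unit : cdom c 1%g)
  (G_noncompact : ~ compact [set: G])
  (g_semisimple : semisimple (lie_bracket c))
  (k p h0 : {vspace 'rV[R]_n})
  (kp_cartan : cartan_decomposition (lie_bracket c) k p)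
  (h0_maximal : maximal_abelian_in (lie_bracket c) k h0)
  (h0_cartan : cartan_subalgebra (cbr (lie_bracket c)) (csubspace h0))
  (Dpos : set (hRdual h0)) (Dpos_positive : positive_system (lie_bracket c) Dpos)
  (phi psi : hRdual h0) (lambda mu : R)
  (phi_dominant : dominant_chamber (lie_bracket c) Dpos phi)
  (psi_dominant : dominant_chamber (lie_bracket c) Dpos psi)
  (phi_isotropy : compact (isotropy c (ihvec (lie_bracket c) phi)))
  (psi_isotropy : compact (isotropy c (ihvec (lie_bracket c) psi)))
  (phi_prime : prime_dual (lie_bracket c) k p Dpos phi = lambda *: phi)
  (psi_prime : prime_dual (lie_bracket c) k p Dpos psi = mu *: psi) :
  ((lambda < 0 /\ mu < 0) \/ (lambda = 0 /\ mu = 0) \/ (0 < lambda /\ 0 < mu))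
  /\ (lambda < 0 -> mu < 0 ->
      (exists a : R, phi = a *: psi) /\ (exists b : R, psi = b *: phi)).
Proof.
have [theta [theta_cartan k_fixed _]] := kp_cartan.
have [h0_k h0_abelian _] := h0_maximal.
have linl := lie_bracket_linl c_atlas c_unit.
have linr := lie_bracket_linr c_atlas c_unit.
have leib := lie_bracket_leibniz c_atlas c_unit.
have h0_fixed h : h \in h0 -> theta h = h.
  by move=> /(subvP h0_k); rewrite k_fixed => /eqP.
have nonzero f : compact (isotropy c (ihvec (lie_bracket c) f)) -> f != 0 :> hRdual h0.
  move=> cf; apply/eqP => f0; apply: G_noncompact.
  move: cf; rewrite f0 /ihvec (hvec0 linl linr theta_cartan k_fixed h0_k) oppr0.
  by rewrite isotropy0.
have regular f : compact (isotropy c (ihvec (lie_bracket c) f)) ->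
    noncompactly_regular (lie_bracket c) theta (h0 := h0) f.
  move=> cf x xp x0; apply/eqP => hx.
  have xv : lie_bracket c x (ihvec (lie_bracket c) f) = 0.
    rewrite (br_anti linl linr leib g_semisimple) /ihvec (brNl linl) hx.
    by rewrite !oppr0.
  have [s [u [s0 u0 xu]]] := noncompact_eigenvector linl linr leib theta_cartan xp x0.
  (* replacing x by - x makes the eigenvalue positive *)
  have [s_lt0|s_gt0|s_eq0] := ltgtP s 0.
  - have Nxv : lie_bracket c (- x) (ihvec (lie_bracket c) f) = 0.
      by rewrite (brNl linl) xv oppr0.
    have Nxu : lie_bracket c (- x) u = - s *: u by rewrite (brNl linl) xu scaleNr.
    have Ns : 0 < - s by rewrite oppr_gt0.
    exact: (isotropy_noncompact c_atlas c_unit g_semisimple Nxv Nxu Ns u0 cf).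
  - exact: (isotropy_noncompact c_atlas c_unit g_semisimple xv xu s_gt0 u0 cf).
  - by rewrite s_eq0 eqxx in s0.
have [signs prop] := prime_dual_proportional linl linr leib theta_cartan k_fixed h0_k
  h0_abelian Dpos_positive (nonzero _ phi_isotropy) (nonzero _ psi_isotropy)
  phi_dominant psi_dominant (regular _ phi_isotropy) (regular _ psi_isotropy)
  phi_prime psi_prime.
split=> // lambda0 mu0; have [a a0 psiE] := prop lambda0 mu0.
split; [exists a^-1 | by exists a].
by rewrite psiE scalerA mulVf // scale1r.
Qed.
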